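(* There is an absolute constant $c>0$ such that for all $n$ and all $\varepsilon$ with $c>\varepsilon\ge 1/\sqrt{n}$, any non-adaptive (possibly two-sided error) $\varepsilon$-testing algorithm for whether an unknown $f:\{0,1\}^n\to\{0,1\}$ is intersecting versus $\varepsilon$-far from intersecting must make $2^{\Omega(n^{1/4}/\sqrt{\varepsilon})}$ queries to $f$.
   Context: Identify $x\in\{0,1\}^n$ with the subset $\{i:x_i=1\}$ of $[n]$. A function $f:\{0,1\}^n\to\{0,1\}$ is intersecting if whenever $f(x)=f(y)=1$ there is $i$ with $x_i=y_i=1$. The distance between $f,g$ is $\Pr_{\mathbf{x}}[f(\mathbf{x})\ne g(\mathbf{x})]$ for uniform $\mathbf{x}$; $f$ is $\varepsilon$-far from intersecting if its distance to every intersecting function is at least $\varepsilon$. An $\varepsilon$-testing algorithm accepts with probability at least $2/3$ every intersecting $f$ and rejects with probability at least $2/3$ every $f$ that is $\varepsilon$-far from intersecting; it is non-adaptive if its queries do not depend on answers to earlier queries. *)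

(* Defs.v *)
From mathcomp Require Import all_boot all_order all_algebra.
From mathcomp Require Import reals exp.

Set Implicit Arguments.
Unset Strict Implicit.
Unset Printing Implicit Defensive.

Import Order.TTheory GRing.Theory Num.Theory.

Local Open Scope ring_scope.

Definition cube (n : nat) := {ffun 'I_n -> bool}.

(* The case x = y is included, so an intersecting f vanishes at the point
   representing the empty set. *)
Definition intersecting (n : nat) (f : cube n -> bool) : Prop :=
  forall x y : cube n, f x -> f y -> exists i : 'I_n, x i && y i.

Definition dist (R : realType) (n : nat) (f g : cube n -> bool) : R :=
  #|[set x : cube n | f x != g x]|%:R / #|{: cube n}|%:R.

Definition far_from_intersecting (R : realType) (n : nat) (eps : R)
    (f : cube n -> bool) : Prop :=
  forall g : cube n -> bool, intersecting g -> eps <= dist R f g.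

(* A deterministic non-adaptive q-query algorithm: the list of query points,
   fixed in advance, and the accept/reject verdict as a function of the q
   answers.  Repeated queries are allowed, so this covers algorithms making at
   most q queries. *)
Definition det_tester (n q : nat) : finType :=
  (q.-tuple (cube n) * {ffun q.-tuple bool -> bool})%type.

Definition accepts (n q : nat) (D : det_tester n q) (f : cube n -> bool)
    : bool :=
  D.2 (map_tuple f D.1).

(* A randomized non-adaptive algorithm is a probability distribution on
   deterministic ones.  Since det_tester n q is a finite type, any source of
   internal randomness (used to choose the queries, the verdict, or both)
   induces such a distribution. *)
Record tester (R : realType) (n q : nat) := Tester {
  law : det_tester n q -> R;
  law_ge0 : forall D, 0 <= law D;
  law_sum1 : \sum_D law D = 1 }.

Definition pr_accept (R : realType) (n q : nat) (A : tester R n q)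
    (f : cube n -> bool) : R :=
  \sum_(D | accepts D f) law A D.

Definition pr_reject (R : realType) (n q : nat) (A : tester R n q)
    (f : cube n -> bool) : R :=
  \sum_(D | ~~ accepts D f) law A D.

Definition tests_intersecting (R : realType) (n q : nat) (eps : R)
    (A : tester R n q) : Prop :=
  (forall f : cube n -> bool, intersecting f -> 2 / 3 <= pr_accept A f) /\
  (forall f : cube n -> bool,
     far_from_intersecting eps f -> 2 / 3 <= pr_reject A f).

(* Main.v *)
Require Import Defs.
From mathcomp Require Import all_boot all_order all_fingroup all_algebra.
From mathcomp Require Import reals exp zify ring lra.

(** Let [A] (action) and [C] (control) be disjoint sets of coordinates with
    [a = |A|] about [sqrt n / eps], let [T_1, ..., T_N] be [s]-subsets of [C]
    with [s] of the order of [a], and give each [T_i] a random bit [b_i].  A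
    point [x] in a window of width about [eps * sqrt n] just below the middle
    layer of the cube on [C], containing exactly one [T_i] and with few elements
    in [A], is accepted according to [b_i].  The complement of such a point [z],
    but with many elements in [A], is accepted according to [b_i] in the no
    case and according to its negation in the yes case.  In the yes case two
    accepted disjoint sets would give [x] included in [z] with the same [T_i]
    and contradictory bits.  In the no case the pairs [x], [z] that agree on [C]
    and lie in symmetric layers of [A] are violated, and covering them requires
    an eps-fraction of the cube.

    After a random permutation of the coordinates, queries can distinguish the
    two cases only if some queried [x] and [z] contain the same [T_i].  Put
    [D = z \ x] and let [l] be of the order of [sqrt a].  If [|D|] is below
    [n / (32 l)], then [A] rarely catches [l] elements of [D]; otherwise [D]
    takes a fraction of order [1 / l] of [C] away from [z], and a union bound
    over the [T_i] gives [exp (- s / (64 l))].  Both are [2 ^ (- l)] up to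
    constants, and [l] is of the order of [n^(1/4) / sqrt eps]. *)

Set Implicit Arguments.
Unset Strict Implicit.
Unset Printing Implicit Defensive.

(** * Binomial coefficients *)

(** Bernoulli's inequality for [1 + t / u], multiplied through by [u ^ m.+1]. *)
Lemma bernoulli_lower (u t m : nat) : u ^ m * (u + m * t) <= u * (u + t) ^ m.
Proof.
elim: m => [|m IH]; first by rewrite !expn0; lia.
rewrite !expnS.
have H : (u * u ^ m) * (u + m.+1 * t) <= (u + t) * (u ^ m * (u + m * t)).
  rewrite [u * _]mulnC -mulnA [X in _ <= X]mulnCA.
  rewrite leq_mul2l; apply/orP; right; nia.
apply: leq_trans H _.
by rewrite [X in _ <= X]mulnCA leq_mul2l IH orbT.
Qed.

(** Bernoulli's inequality for [1 - t / u]; once [m * t] exceeds [u], truncated subtraction makes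
    the left side zero. *)
Lemma bernoulli_upper (u t m : nat) : t <= u -> u ^ m * (u - m * t) <= u * (u - t) ^ m.
Proof.
move=> tu; elim: m => [|m IH]; first by rewrite !expn0; lia.
rewrite !expnS.
have H : (u * u ^ m) * (u - m.+1 * t) <= (u - t) * (u ^ m * (u - m * t)).
  rewrite [u * _]mulnC -mulnA [X in _ <= X]mulnCA.
  rewrite leq_mul2l; apply/orP; right; nia.
apply: leq_trans H _.
by rewrite [X in _ <= X]mulnCA leq_mul2l IH orbT.
Qed.

(** Factor by factor, [(u - k) / (v - k)] is at most [u / v]. *)
Lemma ffact_ratio (u v s : nat) : u <= v -> u ^_ s * v ^ s <= u ^ s * v ^_ s.
Proof.
move=> uv; elim: s => [|s IH]; first by rewrite !expn0 !ffactn0.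
rewrite !ffactnSr !expnSr.
rewrite mulnACA [X in _ <= X]mulnACA; apply: leq_mul => //; nia.
Qed.

(** Factor by factor, [(u - k) / (v - k)] is at least [(u - s) / (v - s)] for [k < s]. *)
Lemma ffact_ratio_shift (u v s : nat) :
  s <= u -> u <= v -> (u - s) ^ s * v ^_ s <= u ^_ s * (v - s) ^ s.
Proof.
move=> su uv.
suff H k : k <= s -> (u - s) ^ k * v ^_ k <= u ^_ k * (v - s) ^ k by exact: H.
elim: k => [|k IH] ks; first by rewrite !expn0 !ffactn0.
rewrite !ffactnSr !expnSr.
rewrite mulnACA [X in _ <= X]mulnACA; apply: leq_mul; first by apply: IH; lia.
nia.
Qed.

Lemma ffact_leq_exp (u s : nat) : u ^_ s <= u ^ s.
Proof.
elim: s => [|s IH]; first by rewrite ffactn0.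
by rewrite ffactnSr expnSr leq_mul // leq_subr.
Qed.

Lemma leq_ffact2 (u v s : nat) : u <= v -> u ^_ s <= v ^_ s.
Proof.
move=> uv; elim: s => [|s IH]; first by rewrite !ffactn0.
by rewrite !ffactnSr leq_mul // leq_sub2r.
Qed.

Lemma bin_leq_exp2 (m j : nat) : 'C(m, j) <= 2 ^ m.
Proof.
have [jm|mj] := leqP j m; last by rewrite bin_small.
rewrite -[2]/(1 + 1) expnDn (bigD1 (Ordinal (jm : j < m.+1))) //=.
by rewrite !exp1n !muln1 leq_addr.
Qed.

(** A weak form of Stirling's formula: every factor of [(j + j) ^_ j] is at least [j], and this
    falling factorial is [j!] times a binomial coefficient of at most [4 ^ j]. *)
Lemma selfexp_leq_fact (j : nat) : j ^ j <= 4 ^ j * j`!.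
Proof.
have H : j ^ j <= (j + j) ^_ j.
  suff H k : k <= j -> j ^ k <= (j + j) ^_ k by exact: H.
  elim: k => [|k IH] kj; first by rewrite ffactn0.
  rewrite ffactnSr expnSr; apply: leq_mul; first by apply: IH; lia.
  lia.
apply: leq_trans H _; rewrite -bin_ffact leq_mul2r; apply/orP; right.
by apply: leq_trans (bin_leq_exp2 _ _) _; rewrite addnn -muln2 mulnC expnM.
Qed.

Lemma bin_central_rec (m : nat) :
  m.+1 * 'C(m.+1.*2, m.+1) = 2 * m.*2.+1 * 'C(m.*2, m).
Proof.
rewrite doubleS -mul_bin_diag /=.
have -> : 'C(m.*2.+1, m) = 'C(m.*2.+1, m.+1).
  by rewrite -bin_sub; [congr binomial; lia | lia].
have := mul_bin_diag m.*2.+1 m; rewrite /=.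
nia.
Qed.

(** Squaring avoids the square root in the bound [4 ^ h / (2 sqrt h)]. After the recurrence, the
    induction step is [4 (h + 1) (h + 2) <= (2 h + 3) ^ 2]. *)
Lemma bin_central_lower (h : nat) :
  0 < h -> 16 ^ h <= 4 * h * 'C(h.*2, h) ^ 2.
Proof.
case: h => // h _; elim: h => [|h IH]; first by [].
have E := bin_central_rec h.+1.
rewrite -(@leq_pmul2l (h.+2 ^ 2)) ?expn_gt0 //.
have -> : h.+2 ^ 2 * (4 * h.+2 * 'C(h.+2.*2, h.+2) ^ 2) =
    4 * h.+2 * (h.+2 * 'C(h.+2.*2, h.+2)) ^ 2 by rewrite expnMn; ring.
rewrite E.
rewrite expnS.
move: ('C(h.+1.*2, h.+1)) IH => B IH.
rewrite -(@leq_pmul2l h.+1) //.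
set P := 16 ^ h.+1 in IH *.
apply: (@leq_trans (h.+1 * (h.+2 ^ 2 * (16 * (4 * h.+1 * B ^ 2))))).
  by rewrite !leq_mul2l IH !orbT.
have -> : h.+1 * (h.+2 ^ 2 * (16 * (4 * h.+1 * B ^ 2))) = (h.+1 ^ 2 * h.+2 ^ 2 * 64) * B^2 by ring.
have -> : h.+1 * (4 * h.+2 * (2 * h.+1.*2.+1 * B) ^ 2) = (h.+1 * h.+2 * h.+1.*2.+1 ^ 2 * 16) * B ^ 2.
  by rewrite !expnMn; ring.
rewrite leq_mul2r; apply/orP; right; nia.
Qed.

Lemma bin_central_upper (m : nat) : 'C(m.*2, m) ^ 2 * m.*2.+1 <= 16 ^ m.
Proof.
elim: m => [|m IH] //.
have E := bin_central_rec m.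
rewrite -(@leq_pmul2l (m.+1 ^ 2)) ?expn_gt0 // mulnA -expnMn E [16 ^ _]expnS.
apply: (@leq_trans (m.+1 ^ 2 * (16 * ('C(m.*2, m) ^ 2 * m.*2.+1)))); last first.
  by rewrite !leq_mul2l IH !orbT.
move: ('C(m.*2, m)) => B.
have -> : (2 * m.*2.+1 * B) ^ 2 * m.+1.*2.+1 = (4 * m.*2.+1 ^ 2 * m.+1.*2.+1) * B ^ 2 by rewrite !expnMn; ring.
have -> : m.+1 ^ 2 * (16 * (B ^ 2 * m.*2.+1)) = (m.+1 ^ 2 * 16 * m.*2.+1) * B ^ 2 by ring.
rewrite leq_mul2r; apply/orP; right; nia.
Qed.

Lemma bin_central_max (m j : nat) : 'C(m.*2, j) <= 'C(m.*2, m).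
Proof.
have H k : m <= k -> 'C(m.*2, k) <= 'C(m.*2, m).
  elim: k => [|k IH] mk; first by have -> : m = 0 by lia.
  have [->//|lt] := eqVneq m k.+1.
  apply: leq_trans (IH _); last by lia.
  rewrite -(@leq_pmul2l k.+1) // mul_bin_left leq_mul2r; apply/orP; right; lia.
have [/H//|jm] := leqP m j.
by rewrite -bin_sub; [apply: H; lia | lia].
Qed.

Lemma bin_upper (a j : nat) : ~~ odd a -> 'C(a, j) ^ 2 * a <= 4 ^ a.
Proof.
move=> /even_halfK <-; set m := a./2.
apply: leq_trans (_ : _ <= 'C(m.*2, m) ^ 2 * m.*2.+1) _.
  by apply: leq_mul => //; rewrite leq_exp2r // bin_central_max.
apply: leq_trans (bin_central_upper m) _.
by rewrite -addnn expnD -expnMn.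
Qed.

(** The ratio of the two coefficients is [(h + j) ^_ j / h ^_ j], at most [(h / (h - j)) ^ j].
    Bernoulli gives [(1 - j / h) ^ j >= 1 - j ^ 2 / h >= 1 / 2]. *)
Lemma bin_near_central (h j : nat) :
  2 * j ^ 2 <= h -> 'C(h.*2, h) <= 2 * 'C(h.*2, h - j).
Proof.
move=> hj.
have jh : j <= h by nia.
have [->|h0] := eqVneq h 0; first by rewrite sub0n double0 bin0; lia.
have E : 'C(h.*2, h) * h ^_ j = 'C(h.*2, h - j) * (h + j) ^_ j.
  apply/eqP; rewrite -(eqn_pmul2r (fact_gt0 (h - j))) -(eqn_pmul2r (fact_gt0 h)); apply/eqP.
  have B1 := @bin_fact h.*2 h ltac:(lia).
  have B2 := @bin_fact h.*2 (h - j) ltac:(lia).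
  have F1 := @ffact_fact h j jh.
  have F2 := @ffact_fact (h + j) j ltac:(lia).
  have e1 : h.*2 - h = h by lia.
  have e2 : h.*2 - (h - j) = h + j by lia.
  have e3 : h + j - j = h by lia.
  rewrite e1 in B1; rewrite e2 in B2; rewrite e3 in F2.
  have -> : 'C(h.*2, h) * h ^_ j * (h - j)`! * h`! = 'C(h.*2, h) * (h ^_ j * (h - j)`!) * h`! by ring.
  have -> : 'C(h.*2, h - j) * (h + j) ^_ j * (h - j)`! * h`! =
    'C(h.*2, h - j) * (h-j)`! * ((h + j) ^_ j * h`!) by ring.
  by rewrite F1 F2 -mulnA B1 -mulnA B2.
have G : (h - j) ^ j * (h + j) ^_ j <= h ^_ j * h ^ j.
  by have := @ffact_ratio_shift h (h + j) j jh (leq_addr _ _); rewrite addnK.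
have Bn := @bernoulli_upper h j j jh.
have P : h ^ j * h <= 2 * (h * (h - j) ^ j).
  apply: leq_trans (_ : _ <= 2 * (h ^ j * (h - j * j))) _; last by rewrite leq_mul2l.
  by rewrite mulnCA leq_mul2l; apply/orP; right; nia.
have P' : h ^ j <= 2 * (h - j) ^ j.
  by rewrite -(@leq_pmul2r h) ?lt0n //; lia.
have f0 : 0 < h ^_ j by rewrite ffact_gt0.
have f1 : 0 < (h + j) ^_ j by rewrite ffact_gt0 leq_addl.
have G2 : (h + j) ^_ j <= 2 * h ^_ j.
  have h'0 : 0 < h ^ j by rewrite expn_gt0 lt0n h0.
  rewrite -(@leq_pmul2l (h ^ j)) //.
  apply: leq_trans (_ : _ <= 2 * ((h - j) ^ j * (h + j) ^_ j)) _.
    by rewrite mulnA leq_mul2r P' orbT.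
  by rewrite [X in _ <= X]mulnCA leq_mul2l [h ^ j * _]mulnC G.
rewrite -(@leq_pmul2r (h ^_ j)) // E.
by rewrite [2 * _]mulnC -mulnA leq_mul2l G2 orbT.
Qed.

(** * Random permutations *)

(* Conditioned on [E] and on [pi] mapping [K'] into [W], all points of
   [C :\: K'] are equally likely to be mapped into [W]. *)
Lemma card_perm_sub (I : finType) (C K : {set I}) (E : pred {perm I})
    (W : {set I}) (w : nat) :
  {in C &, forall j l pi, E (tperm j l * pi)%g = E pi} ->
  (forall pi, E pi -> #|[set l in C | pi l \in W]| <= w) ->
  K \subset C ->
  #|[set pi : {perm I} | E pi & [forall j in K, pi j \in W]]| * #|C| ^_ #|K|
    <= w ^_ #|K| * #|[set pi | E pi]|.
Proof.
move=> Einv Ew; move: {2}#|K| (erefl #|K|) => k.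
elim: k K => [|k IH] K Kk KC.
  rewrite Kk !ffactn0 mul1n muln1 subset_leq_card //.
  by apply/subsetP => pi; rewrite !inE => /andP[].
have [j jK] : exists j, j \in K by apply/set0Pn; rewrite -cards_eq0 Kk.
pose K' := K :\ j.
have K'k : #|K'| = k by move: (cardsD1 j K); rewrite jK Kk => -[].
have K'C : K' \subset C by apply: subset_trans KC; apply: subsetDl.
have {IH} IH := IH K' K'k K'C; rewrite K'k in IH; rewrite Kk.
set NK := #|[set pi | _ & [forall j in K, _]]|.
set A' := [set pi : {perm I} | E pi & [forall j in K', pi j \in W]] in IH.
have jC : j \in C by apply: (subsetP KC).
(* Composing with the transposition of [j] and [l] preserves [E] and fixes [K'] pointwise, so it
   carries the permutations counted for [l] onto those counted for [j]. *)
have NKe l : l \in C :\: K' -> #|[set pi in A' | pi l \in W]| = NK.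
  rewrite inE => /andP[lK' lC].
  rewrite /NK -(card_imset _ (mulgI (tperm j l))); congr #|pred_of_set _|.
  have fixK i : i \in K' -> tperm j l i = i.
    move=> iK'; rewrite tpermD //; first by move: iK'; rewrite !inE eq_sym => /andP[].
    by apply: contraNneq lK' => ->.
  apply/setP => pi; apply/imsetP/idP.
    case=> rho; rewrite !inE => /andP[/andP[Er /forall_inP rK'] rl] ->.
    rewrite Einv // Er /=; apply/forall_inP => i iK; rewrite permM.
    have [->|ij] := eqVneq i j; first by rewrite tpermL.
    have iK' : i \in K' by rewrite !inE ij.
    by rewrite fixK //; apply: rK'.
  rewrite inE => /andP[Epi /forall_inP pK].
  exists (tperm j l * pi)%g; last by rewrite mulgA tperm2 mul1g.
  rewrite !inE Einv // Epi /= permM tpermR pK // andbT.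
  apply/forall_inP => i iK'; rewrite permM fixK //; apply: pK.
  by move: iK'; rewrite !inE => /andP[].
(* Double counting of pairs [(l, pi)]: a permutation in [A'] already sends the [k] points of [K']
   into [W], which leaves at most [w - k] choices of [l]. *)
have S : (#|C| - k) * NK <= (w - k) * #|A'|.
  have -> : #|C| - k = #|C :\: K'|.
    by rewrite cardsD (setIidPr K'C) K'k.
  rewrite -sum_nat_const.
  rewrite (eq_bigr (fun l => \sum_(pi in A') (pi l \in W : nat))); last first.
    move=> l lC; rewrite -(NKe l lC) -sum1_card big_mkcond /=.
    by rewrite [RHS]big_mkcond; apply: eq_bigr => pi _; rewrite inE; case: (pi \in A'); case: (pi l \in W).
  rewrite exchange_big /= mulnC -sum_nat_const; apply: leq_sum => pi.
  rewrite inE => /andP[Epi /forall_inP pK'].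
  have := Ew pi Epi; set L := [set l in C | _] => Lw.
  have K'L : K' \subset L.
    by apply/subsetP => i iK'; rewrite inE pK' // (subsetP K'C).
  apply: leq_trans (_ : #|L :\: K'| <= _); last first.
    by rewrite cardsD (setIidPr K'L) K'k leq_sub2r.
  rewrite -sum1_card big_mkcond [X in _ <= X]big_mkcond leq_sum // => l _.
  have KE (X : {set I}) : (l \in X :\: K') = (l \notin K') && (l \in X) by rewrite in_setD.
  by rewrite !KE [l \in L]inE; case: (l \in K'); case: (l \in C); case: (l \in W).
rewrite !ffactnSr.
apply: leq_trans (_ : (w - k) * (#|A'| * #|C| ^_ k) <= _).
  rewrite (_ : NK * _ = (#|C| - k) * NK * #|C| ^_ k); last by ring.
  by rewrite mulnA leq_mul2r S orbT.
by rewrite [w ^_ k * _]mulnC -mulnA leq_mul2l IH orbT.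
Qed.

Lemma card_preim_perm (I : finType) (pi : {perm I}) (D : {set I}) :
  #|[set l | pi l \in D]| = #|D|.
Proof.
rewrite -(card_imset _ (@perm_inj _ pi)); apply: eq_card => x.
apply/imsetP/idP => [[l]|xD]; first by rewrite inE => lD ->.
by exists (pi^-1 x)%g; rewrite ?inE permKV.
Qed.

Lemma card_perm_all (I : finType) : #|{: {perm I}}| = #|I|`!.
Proof.
by rewrite -cardsT -card_perm; apply: eq_card => s; rewrite !inE; apply/esym/subsetP => x; rewrite !inE.
Qed.

Lemma card_perm_sub_exp (I : finType) (K D : {set I}) :
  #|[set pi : {perm I} | [forall j in K, pi j \in D]]| * #|I| ^ #|K|
    <= #|D| ^ #|K| * #|I|`!.
Proof.
have Dw (pi : {perm I}) : predT pi -> #|[set l in [set: I] | pi l \in D]| <= #|D|.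
  move=> _; rewrite -[X in _ <= X](card_preim_perm pi D) subset_leq_card //.
  by apply/subsetP => l; rewrite !inE.
have := @card_perm_sub I [set: I] K predT D #|D| (fun _ _ _ _ _ => erefl) Dw (subsetT K).
have -> : #|[set pi : {perm I} | predT pi]| = #|I|`!.
  by rewrite -card_perm_all; apply: eq_card => s; rewrite !inE.
rewrite cardsT /=; set N := #|_|.
have f0 : 0 < #|I| ^_ #|K| by rewrite ffact_gt0 max_card.
have := @ffact_ratio #|D| #|I| #|K| (max_card _).
move=> H1 H2; rewrite -(@leq_pmul2r (#|I| ^_ #|K|)) //.
rewrite mulnAC; apply: (leq_trans (leq_mul H2 (leqnn _))).
by rewrite mulnAC [X in _ <= X]mulnAC leq_mul2r H1 orbT.
Qed.

(** The threshold [j] is at least eight times the mean [#|A| * #|D| / #|I|]. A union bound over the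
    [j]-subsets of [A] sent into [D] gives ['C(a, j) (d / m) ^ j], at most [(4 a d / (j m)) ^ j] by
    the weak Stirling bound, hence at most [2 ^ (- j)]. *)
Lemma card_perm_tail (I : finType) (A D : {set I}) (j : nat) :
  8 * #|A| * #|D| <= j * #|I| ->
  2 ^ j * #|[set pi : {perm I} | j <= #|[set l in A | pi l \in D]|]| <= #|I|`!.
Proof.
set a := #|A|; set d := #|D|; set m := #|I| => H.
have [->|j0] := posnP j.
  by rewrite mul1n -card_perm_all max_card.
have [m0|m0] := posnP m.
  have Ie (X : {set I}) : #|X| = 0 by apply/eqP; rewrite -leqn0 -m0 max_card.
  rewrite (_ : [set _ | _] = set0) ?cards0 ?muln0 //.
  by apply/setP => pi; rewrite !inE Ie leqNgt j0.
set N := #|_|.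
have N1 : N * m ^ j <= 'C(a, j) * (d ^ j * m`!).
  have -> : 'C(a, j) = #|[set K : {set I} | K \subset A & #|K| == j]| by rewrite cards_draws.
  rewrite -sum_nat_const.
  apply: leq_trans (_ : \sum_(K in [set K : {set I} | K \subset A & #|K| == j])
     #|[set pi : {perm I} | [forall i in K, pi i \in D]]| * m ^ j <= _); last first.
    apply: leq_sum => K; rewrite inE => /andP[_ /eqP <-].
    exact: card_perm_sub_exp.
  rewrite -big_distrl leq_mul2r; apply/orP; right.
  rewrite (eq_bigr (fun K : {set I} => \sum_(pi : {perm I}) ([forall i in K, pi i \in D] : nat))); last first.
    by move=> K _; rewrite -sum1_card big_mkcond; apply: eq_bigr => pi _; rewrite inE; case: ifP.
  rewrite exchange_big /N -sum1_card big_mkcond; apply: leq_sum => pi _ /=.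
  rewrite inE; case: ifP => // jl.
  have : 0 < #|[set K : {set I} | K \subset [set l in A | pi l \in D] & #|K| == j]|.
    by rewrite cards_draws bin_gt0.
  case/card_gt0P => K; rewrite inE => /andP[/subsetP KS Kj].
  rewrite (bigD1 K) /=; last first.
    rewrite inE Kj andbT; apply/subsetP => x /KS; by rewrite inE => /andP[].
  have -> : [forall i in K, pi i \in D] = true by apply/forall_inP => i /KS; rewrite inE => /andP[].
  by [].
have E1 := bin_ffact a j.
have E2 := ffact_leq_exp a j.
have E3 := selfexp_leq_fact j.
have jm0 : 0 < (j * m) ^ j by rewrite expn_gt0 muln_gt0 j0 m0.
rewrite -(@leq_pmul2r ((j * m) ^ j)) //.
apply: (@leq_trans (m`! * (8 * a * d) ^ j)); last first.
  by rewrite leq_mul2l leq_exp2r // H orbT.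
have -> : 8 * a * d = 2 * (4 * (a * d)) by lia.
rewrite !expnMn.
apply: leq_trans (_ : 2 ^ j * (N * m ^ j * (4 ^ j * j`!)) <= _).
  have -> : 2 ^ j * N * (j ^ j * m ^ j) = 2 ^ j * (N * m ^ j * j ^ j) by ring.
  by rewrite !leq_mul2l E3 !orbT.
rewrite [m`! * _]mulnCA leq_mul2l; apply/orP; right.
apply: leq_trans (_ : 'C(a, j) * (d ^ j * m`!) * (4 ^ j * j`!) <= _).
  by rewrite leq_mul2r N1 orbT.
have -> : 'C(a, j) * (d ^ j * m`!) * (4 ^ j * j`!) = ('C(a, j) * j`!) * (d ^ j * m`! * 4 ^ j) by ring.
rewrite E1.
have -> : m`! * (4 ^ j * (a ^ j * d ^ j)) = a ^ j * (d ^ j * m`! * 4 ^ j) by ring.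
by rewrite leq_mul2r E2 orbT.
Qed.

(** * Layers of the cube *)

Lemma card_subset_range (I : finType) (C : {set I}) (P : pred nat) :
  #|[set c : {set I} | c \subset C & P #|c|]|
    = \sum_(k < #|C|.+1 | P k) 'C(#|C|, k).
Proof.
rewrite -sum1_card (partition_big (fun c : {set I} => inord #|c| : 'I_#|C|.+1) P) /=.
  apply: eq_bigr => k Pk.
  transitivity #|[set c : {set I} | c \subset C & #|c| == k]|; last by rewrite cards_draws.
  rewrite -[RHS]sum1_card; apply: eq_bigl => c; rewrite !inE.
  case cC: (c \subset C) => //=.
  have cl : #|c| < #|C|.+1 by rewrite ltnS subset_leq_card.
  apply/andP/eqP => [[_ /eqP <-]|ck]; first by rewrite inordK.
  by split; [rewrite ck | apply/eqP/val_inj; rewrite /= inordK].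
move=> c; rewrite inE => /andP[/subset_leq_card cC Pc].
by rewrite inordK.
Qed.

Lemma card_window_lower (I : finType) (C : {set I}) (h w : nat) :
  #|C| = h.*2 -> 2 * w ^ 2 <= h ->
  w * 'C(h.*2, h) <= 2 * #|[set c : {set I} | c \subset C & h - w <= #|c| < h]|.
Proof.
move=> Ch wh; rewrite (card_subset_range C (fun k => h - w <= k < h)) Ch.
have wlh : w <= h by nia.
rewrite -(big_mkord (fun k => h - w <= k < h) (fun k => 'C(h.*2, k))).
have -> : \sum_(0 <= k < h.*2.+1 | h - w <= k < h) 'C(h.*2, k) =
    \sum_(h - w <= k < h) 'C(h.*2, k).
  rewrite (@big_nat_widenl _ _ _ (h - w) 0) // (@big_nat_widen _ _ _ 0 h h.*2.+1); last by lia.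
  by apply: eq_bigl.
rewrite big_distrr /= -{1}(subKn wlh) -sum_nat_const_nat.
rewrite big_nat_cond [X in _ <= X]big_nat_cond; apply: leq_sum => k /andP[/andP[hk kh] _].
have := @bin_near_central h (h - k); rewrite subKn ?(ltnW kh) //; apply.
by have : h - k <= w by [lia]; nia.
Qed.

Lemma card_fibers (T : finType) (S : {set T}) (f : T -> nat) (m : nat) :
  (forall x, x \in S -> f x <= m) ->
  #|S| = \sum_(k < m.+1) #|[set x in S | f x == k]|.
Proof.
move=> fm; rewrite -sum1_card (partition_big (fun x => inord (f x) : 'I_m.+1) xpredT) //=.
apply: eq_bigr => k _; rewrite -sum1_card; apply: eq_bigl => x; rewrite inE.
case xS: (x \in S) => //=.
by rewrite -val_eqE /= inordK // ltnS fm.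
Qed.

(** With [l = r.*2] and [a = 4 l ^ 2], fewer than [l] layers are neither low nor high, and each has
    at most [2 ^ a / sqrt a = 2 ^ a / (2 l)] points. They fill at most half of the cube, and
    complementation splits the rest evenly. *)
Lemma card_low_lower (I : finType) (A : {set I}) (r : nat) :
  #|A| = 4 * r.*2 ^ 2 -> 0 < r ->
  2 ^ #|A| <= 4 * #|[set u : {set I} | u \subset A & #|u|.*2 + r.*2 <= #|A|]|.
Proof.
move=> Aa r0; rewrite (card_subset_range A (fun k => k.*2 + r.*2 <= #|A|)).
set a := #|A| in Aa *; pose l := r.*2.
pose F (k : nat) := 'C(a, k).
have tot : 2 ^ a = \sum_(k < a.+1) F k.
  by rewrite -[2]/(1 + 1) expnDn; apply: eq_bigr => k _; rewrite !exp1n !muln1.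
have highE : \sum_(k < a.+1 | a + l <= k.*2) F k = \sum_(k < a.+1 | k.*2 + l <= a) F k.
  rewrite (reindex_inj rev_ord_inj) /=; apply: eq_big => [k|k _].
    by rewrite subSS; have := ltn_ord k; lia.
  by rewrite /F subSS bin_sub // -ltnS.
have central : 2 * \sum_(k < a.+1 | ~~ (k.*2 + l <= a) && ~~ (a + l <= k.*2)) F k <= 2 ^ a.
  have l0 : 0 < l by rewrite /l; lia.
  rewrite -(@leq_pmul2r l) //.
  apply: leq_trans (_ : \sum_(k < a.+1 | ~~ (k.*2 + l <= a) && ~~ (a + l <= k.*2)) 2 ^ a <= _).
    rewrite mulnAC mulnC big_distrl; apply: leq_sum => k _ /=.
    rewrite -leq_sqr expnMn [F k]/F.
    have -> : (2 * l) ^ 2 = a by rewrite Aa /l expnMn.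
    rewrite -expnM [X in _ <= X](_ : _ = 4 ^ a); last by rewrite mulnC expnM.
    by rewrite bin_upper // Aa oddM.
  rewrite -(big_mkord (fun k => ~~ (k.*2 + l <= a) && ~~ (a + l <= k.*2)) (fun _ => 2 ^ a)).
  apply: leq_trans (_ : \sum_(a./2 - r <= k < a./2 + r) 2 ^ a <= _).
    rewrite (@big_nat_widenl _ _ _ (a./2 - r) 0) // (@big_nat_widen _ _ _ 0 (a./2 + r) a.+1); last first.
      by rewrite Aa; nia.
    rewrite [X in X <= _]big_mkcond [X in _ <= X]big_mkcond; apply: leq_sum => k _.
    case: ifP => //; case: ifP => // H1 H2.
    by move: H1 H2; rewrite /l Aa; lia.
  rewrite sum_nat_const_nat mulnC leq_mul2l; apply/orP; right.
  by rewrite /l; lia.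
have -> : \sum_(k < a.+1 | k.*2 + r.*2 <= a) 'C(a, k) = \sum_(k < a.+1 | k.*2 + l <= a) F k by [].
move: tot; rewrite (bigID (fun k : 'I_a.+1 => k.*2 + l <= a)) /=.
rewrite [X in _ + X](bigID (fun k : 'I_a.+1 => a + l <= k.*2)) /=.
have -> : \sum_(i < a.+1 | ~~ (i.*2 + l <= a) && (a + l <= i.*2)) F i =
   \sum_(k < a.+1 | a + l <= k.*2) F k.
  by apply: eq_bigl => k; rewrite /l; lia.
rewrite highE; move: central; rewrite /=.
set Y := (X in 2 * X <= _); set Z := \sum_(_ < _ | _) _; lia.
Qed.

(* The comparability graph between layers [k] and [a - k] is regular, so a
   vertex cover has at least as many elements as one layer. *)
Lemma layer_vertex_cover (I : finType) (A : {set I}) (P Q : pred {set I}) (k : nat) :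
  k.*2 <= #|A| ->
  (forall u v : {set I}, u \subset v -> v \subset A -> #|u| = k ->
     #|v| = #|A| - k -> P u || Q v) ->
  'C(#|A|, k) <= #|[set u : {set I} | [&& u \subset A, #|u| == k & P u]]|
    + #|[set v : {set I} | [&& v \subset A, #|v| == #|A| - k & Q v]]|.
Proof.
set a := #|A| => ka cov; set d := 'C(a - k, k).
have d0 : 0 < d by rewrite bin_gt0; lia.
pose L := [set u : {set I} | u \subset A & #|u| == k].
pose H := [set v : {set I} | v \subset A & #|v| == a - k].
have degH v : v \in H -> \sum_(u in L) (u \subset v : nat) = d.
  rewrite inE => /andP[vA /eqP vk]; rewrite /d -vk -cards_draws -sum1_card.
  rewrite [LHS]big_mkcond [RHS]big_mkcond; apply: eq_bigr => u _; rewrite !inE.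
  case uv: (u \subset v) => /=; last by case: ifP.
  by rewrite (subset_trans uv vA).
have degL u : u \in L -> \sum_(v in H) (u \subset v : nat) = d.
  rewrite inE => /andP[uA /eqP uk].
  have Duk : #|A :\: u| = a - k by rewrite cardsD (setIidPr uA) uk.
  rewrite /d -Duk -cards_draws -sum1_card.
  (* Complementation in [A] turns the supersets of [u] of size [a - k] into the [k]-subsets of
     [A :\: u]. *)
  rewrite (reindex_onto (fun w => A :\: w) (fun v => A :\: v)) /=; last first.
    by move=> v; rewrite inE => /andP[vA _]; rewrite setDDr setDv set0U (setIidPr vA).
  rewrite [LHS]big_mkcond [RHS]big_mkcond; apply: eq_bigr => w _; rewrite !inE.
  rewrite setDDr setDv set0U subsetDl /=.
  have [wA|nwA] := boolP (w \subset A); last first.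
    have -> : (A :&: w == w) = false.
      by apply: contraNF nwA => /eqP <-; rewrite subsetIl.
    rewrite andbF; case: ifP => // /andP[wAu _]; move: nwA.
    by rewrite (subset_trans wAu (subsetDl _ _)).
  rewrite (setIidPr wA) eqxx andbT cardsD (setIidPr wA).
  have wa := subset_leq_card wA.
  have -> : (#|A| - #|w| == a - k) = (#|w| == k) by rewrite /a in ka wa *; lia.
  rewrite !subsetD wA uA /= [[disjoint u & w]]disjoint_sym andbC.
  by case: (_ == k) => //=; case: ifP.
rewrite -(@leq_pmul2r d) // -[X in X * d]cards_draws -/L mulnDl.
pose LP := [set u : {set I} | [&& u \subset A, #|u| == k & P u]].
pose HQ := [set v : {set I} | [&& v \subset A, #|v| == a - k & Q v]].
(* [S1] counts all edges, [S2] those whose lower end is in the cover, and [S3] those whose upper end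
   is. *)
have S1 : #|L| * d = \sum_(u in L) \sum_(v in H) (u \subset v : nat).
  by rewrite -sum_nat_const; apply: eq_bigr => u /degL.
have S2 : #|LP| * d = \sum_(u in L) \sum_(v in H) (u \subset v) * P u.
  rewrite -sum_nat_const.
  rewrite [LHS]big_mkcond [RHS]big_mkcond; apply: eq_bigr => u _.
  have [uL|uL] := boolP (u \in L); last first.
    by case: ifP => //; move: uL; rewrite !inE andbA => /negbTE ->.
  have -> : (u \in LP) = P u by move: uL; rewrite !inE andbA => ->.
  by rewrite -big_distrl /= degL //; case: (P u); rewrite ?muln1 ?muln0.
have S3 : #|HQ| * d = \sum_(u in L) \sum_(v in H) (u \subset v) * Q v.
  rewrite exchange_big -sum_nat_const /=.
  rewrite [LHS]big_mkcond [RHS]big_mkcond; apply: eq_bigr => u _.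
  have [uL|uL] := boolP (u \in H); last first.
    by case: ifP => //; move: uL; rewrite !inE andbA => /negbTE ->.
  have -> : (u \in HQ) = Q u by move: uL; rewrite !inE andbA => ->.
  by rewrite -big_distrl /= degH //; case: (Q u); rewrite ?muln1 ?muln0.
rewrite S1 S2 S3 -big_split /=; apply: leq_sum => u; rewrite inE => /andP[uA /eqP uk].
rewrite -big_split /=; apply: leq_sum => v; rewrite inE => /andP[vA /eqP vk].
case uv: (u \subset v) => //=.
by have := cov u v uv vA uk vk; case: (P u); case: (Q v).
Qed.

(** Each low layer [k] is matched with its mirror layer [#|A| - k], and the bounds for these
    disjoint pairs of layers add up. This is why the high sets are sorted by [a - #|u|]. *)
Lemma low_high_vertex_cover (I : finType) (A : {set I}) (P Q : pred {set I}) (l : nat) :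
  (forall u v : {set I}, u \subset v -> v \subset A ->
     #|u|.*2 + l <= #|A| -> #|A| + l <= #|v|.*2 -> P u || Q v) ->
  #|[set u : {set I} | u \subset A & #|u|.*2 + l <= #|A|]| <=
    #|[set u : {set I} | [&& u \subset A, #|u|.*2 + l <= #|A| & P u]]|
    + #|[set v : {set I} | [&& v \subset A, #|A| + l <= #|v|.*2 & Q v]]|.
Proof.
move=> cov; set a := #|A|.
rewrite (card_subset_range A (fun k => k.*2 + l <= a)) -/a.
rewrite (@card_fibers _ _ (fun u : {set I} => #|u|) a); last first.
  by move=> u; rewrite inE => /and3P[/subset_leq_card].
rewrite (@card_fibers _ _ (fun u : {set I} => a - #|u|) a); last first.
  by move=> u _; apply: leq_subr.
rewrite -big_split /= big_mkcond; apply: leq_sum => k _.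
case: ifP => // kl.
apply: leq_trans (_ : _ <= #|[set u : {set I} | [&& u \subset A, #|u| == k & P u]]|
    + #|[set v : {set I} | [&& v \subset A, #|v| == #|A| - k & Q v]]|) _.
  apply: layer_vertex_cover; first by rewrite -/a; lia.
  move=> u v uv vA uk vk; apply: cov => //; rewrite ?uk ?vk -/a; lia.
apply: leq_add; apply: subset_leq_card; apply/subsetP => u; rewrite !inE.
  by move=> /and3P[-> /eqP -> ->]; rewrite kl eqxx.
move=> /and3P[-> /eqP -> ->] /=; rewrite -/a; lia.
Qed.

(** * Existence of a good family of terms *)

Definition uniq_term (I : finType) (N : nat) (T : {ffun 'I_N -> {set I}})
    (z : {set I}) (i : 'I_N) : bool :=
  [forall j, (T j \subset z) == (j == i)].

Lemma uniq_term_inj (I : finType) (N : nat) (T : {ffun 'I_N -> {set I}})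
    (z : {set I}) (i k : 'I_N) :
  T i \subset z -> uniq_term T z k -> i = k.
Proof. by move=> iz /forallP /(_ i); rewrite iz => /eqP/esym/eqP. Qed.

(** First moment method, with independent uniform terms. A fixed [c] contains a given term with
    probability [p], where [N p] lies between [1 / 8] and [1 / 2], so it contains exactly one with
    probability [N p (1 - p) ^ (N - 1) >= 1 / 16]. Some family does as well as the average. *)
Lemma exists_terms (I : finType) (C : {set I}) (Mid : {set {set I}})
    (s N t : nat) :
  0 < 'C(#|C|, s) ->
  (forall c, c \in Mid -> [/\ c \subset C, 'C(#|c|, s) <= t & t <= 2 * 'C(#|c|, s)]) ->
  2 * N * t <= 'C(#|C|, s) -> 'C(#|C|, s) <= 4 * N * t ->
  exists T : {ffun 'I_N -> {set I}},
    (forall i, T i \subset C /\ #|T i| = s) /\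
    #|Mid| <= 16 * #|[set c in Mid | [exists i, uniq_term T c i]]|.
Proof.
set S := 'C(#|C|, s) => S0 midP NS SN.
pose X := [set K : {set I} | K \subset C & #|K| == s].
have XS : #|X| = S by rewrite cards_draws.
pose Fam := [set T : {ffun 'I_N -> {set I}} | [forall i, T i \in X]].
have FamS : #|Fam| = S ^ N.
  rewrite -XS -[in RHS](card_ord N) -card_ffun_on; apply: eq_card => T.
  by rewrite inE; apply/forallP/ffun_onP.
have per c : c \in Mid -> S ^ N <= 16 * \sum_(T in Fam) [exists i, uniq_term T c i].
  move=> cM; have [cC ct tc] := midP c cM; set tt := 'C(#|c|, s) in ct tc.
  pose G (i j : 'I_N) : pred {set I} := [pred K | (K \in X) && ((K \subset c) == (j == i))].
  have Gc i j : #|G i j| = if j == i then tt else S - tt.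
    have XIc : #|[set K in X | K \subset c]| = tt.
      rewrite /tt -cards_draws; apply: eq_card => K; rewrite !inE.
      case Kc: (K \subset c); rewrite ?andbF //=.
      by rewrite (subset_trans Kc cC) andbT.
    have [->|/negbTE ji] := eqVneq j i.
      rewrite -XIc; apply: eq_card => K; rewrite !inE.
      by rewrite eqxx eqb_id.
    rewrite -XS -(cardsID [set K : {set I} | K \subset c] X).
    have -> : X :&: [set K : {set I} | K \subset c] = [set K in X | K \subset c].
      by apply/setP => K; rewrite !inE.
    rewrite XIc addKn; apply: eq_card => K; rewrite !inE ji.
    by case: (K \subset c); rewrite ?andbF ?andbT.
  have famc i : #|family (G i)| = tt * (S - tt) ^ N.-1.
    rewrite card_family foldrE big_map big_enum /= (bigD1 i) //= Gc eqxx; congr (_ * _).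
    rewrite (eq_bigr (fun _ => S - tt)); last by move=> j /negbTE ji; rewrite Gc ji.
    rewrite prod_nat_const; congr (_ ^ _).
    by rewrite (cardC1 i) card_ord.
  (* For different [i] the events that [T i] is the only term inside [c] are disjoint, so their
     counts add. *)
  have sumG : \sum_(T in Fam) [exists i, uniq_term T c i] >= N * (tt * (S - tt) ^ N.-1).
    rewrite -{1}(card_ord N) -sum_nat_const.
    rewrite (eq_bigr (fun i : 'I_N => \sum_(T in Fam) uniq_term T c i)); last first.
      move=> i _; rewrite -(famc i) -sum1_card.
      rewrite [LHS]big_mkcond [RHS]big_mkcond; apply: eq_bigr => T _.
      rewrite [T \in Fam]inE /uniq_term.
      case: familyP => [TG|nTG].
        have TX i0 : T i0 \in X by have := TG i0; rewrite inE => /andP[].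
        have -> : [forall i0, T i0 \in X] by apply/forallP.
        by have -> // : [forall j, (T j \subset c) == (j == i)]; apply/forallP => j; have := TG j; rewrite inE => /andP[].
      case: forallP => // TX; case: forallP => // TU; case: nTG => j.
      by rewrite inE TX TU.
    rewrite exchange_big; apply: leq_sum => T _ /=.
    case: (boolP [exists i, uniq_term T c i]) => [/existsP[i Ti]|/existsPn nT]; last first.
      by rewrite big1 // => i _; rewrite (negbTE (nT i)).
    rewrite (bigD1 i) //= big1 ?addn0 ?leq_b1 // => j ji.
    case Tj: (uniq_term T c j) => //.
    case/eqP: ji; apply: (uniq_term_inj _ Ti).
    by have /forallP/(_ j) := Tj; rewrite eqxx => /eqP.
  apply: leq_trans (leq_mul (leqnn 16) sumG).
  have tS : tt <= S by apply: leq_bin2l; apply: subset_leq_card.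
  have [m Nm] : exists m, N = m.+1 by exists N.-1; case: (N) SN => //; lia.
  rewrite Nm /= expnS in NS SN *.
  have B := @bernoulli_upper S tt m tS.
  have B2 : S ^ m <= 2 * (S - tt) ^ m.
    rewrite -(@leq_pmul2l S) //.
    apply: (@leq_trans (2 * (S ^ m * (S - m * tt)))); last by rewrite [X in _ <= X]mulnCA leq_mul2l.
    rewrite mulnC [2 * _]mulnCA leq_mul2l; apply/orP; right; nia.
  apply: leq_trans (leq_mul SN B2) _.
  have -> : 4 * m.+1 * t * (2 * (S - tt) ^ m) = (8 * m.+1 * (S - tt) ^ m) * t by ring.
  apply: leq_trans (leq_mul (leqnn _) tc) _.
  apply: eq_leq; ring.
have [|noT] := boolP [exists T in Fam, #|Mid| <= 16 * #|[set c in Mid | [exists i, uniq_term T c i]]|].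
  case/exists_inP => T; rewrite inE => /forallP TX TM; exists T; split=> // i.
  by have := TX i; rewrite inE => /andP[? /eqP].
exfalso; move: noT; rewrite negb_exists_in => /forall_inP noT.
pose U (T : {ffun 'I_N -> {set I}}) := #|[set c in Mid | [exists i, uniq_term T c i]]|.
have lower : #|Mid| * S ^ N <= 16 * \sum_(T in Fam) U T.
  rewrite -sum_nat_const.
  apply: (@leq_trans (\sum_(c in Mid) 16 * \sum_(T in Fam) [exists i, uniq_term T c i])).
    exact: leq_sum.
  rewrite -big_distrr leq_mul2l /= exchange_big; apply: leq_sum => T _.
  rewrite /U -sum1_card big_mkcond [X in _ <= X]big_mkcond; apply: leq_sum => c _.
  by rewrite inE; case: (c \in Mid) => //=; case: ifP.
(* If every family fails, the strict inequalities gain one unit per family; the total gain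
   [S ^ N > 0] contradicts [lower]. *)
have upper : \sum_(T in Fam) (16 * U T + 1) <= #|Mid| * S ^ N.
  rewrite mulnC -FamS -sum_nat_const; apply: leq_sum => T TF.
  by rewrite addn1 ltnNge noT.
move: upper; rewrite big_split /= sum1_card FamS -big_distrr /=.
have : 0 < S ^ N by rewrite expn_gt0 S0.
rewrite /= in lower *; lia.
Qed.

(** * The hard functions *)

(** [act] and [ctl] are the action and control sets; [e0], [e1], [e2] are meant to be three further
    coordinates. The size of [ctl] will be twice [half]. [gap] is compared with doubled
    cardinalities, so that no middle layer has to be rounded. *)
Record gadget (I : finType) (N : nat) := Gadget {
  act : {set I};
  ctl : {set I};
  e0 : I; e1 : I; e2 : I;
  half : nat;
  width : nat;
  gap : nat;
  term : {ffun 'I_N -> {set I}} }.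

Definition core (I : finType) (N : nat) (G : gadget I N) (z : {set I}) : bool :=
  [&& e0 G \in z, (e1 G \in z) != (e2 G \in z) &
      half G - width G <= #|z :&: ctl G| < half G].

Definition low (I : finType) (N : nat) (G : gadget I N) (z : {set I}) : bool :=
  #|z :&: act G|.*2 + gap G <= #|act G|.

Definition high (I : finType) (N : nat) (G : gadget I N) (z : {set I}) : bool :=
  #|act G| + gap G <= #|z :&: act G|.*2.

(* [e0] makes any two accepted points below the middle layer meet.  Reading the
   bit [b i] against [(e1, e2)] makes the number of violated pairs independent
   of [b]: [b i] says which of the two patterns of [(e1, e2)] is accepted
   below [T i]; the sets [~: x] use the same bit if [t] is [false] and the
   opposite one if [t] is [true]. *)
Definition hard (I : finType) (N : nat) (G : gadget I N) (t : bool)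
    (b : {ffun 'I_N -> bool}) (x : {set I}) : bool :=
  [&& core G x, low G x &
    [exists i, uniq_term (term G) x i && (b i == (e1 G \in x))]]
  || [&& core G (~: x), high G (~: x) &
    [exists i, uniq_term (term G) (~: x) i && ((b i == (e1 G \in ~: x)) (+) t)]].

(** Only such a pair lets the answers depend on one bit from both sides. Asking for a shared term
    without uniqueness enlarges the event, which is harmless for an upper bound on its
    probability. *)
Definition conflict (I : finType) (N : nat) (G : gadget I N) (x z : {set I}) : bool :=
  [&& core G x, low G x, core G z, high G z &
    [exists i, term G i \subset x :&: z]].

Lemma uniq_term_sub (I : finType) (N : nat) (T : {ffun 'I_N -> {set I}})
    (z : {set I}) (i : 'I_N) : uniq_term T z i -> T i \subset z.
Proof. by move/forallP/(_ i); rewrite eqxx => /eqP. Qed.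

(** If [x] were included in [z], the term of [x] would be the only one in [z], so [i = k]. As each
    point contains exactly one of [e1] and [e2], both would contain the same one, and the two
    conditions on the bit would contradict each other. *)
Lemma hard_low_high_meet (I : finType) (N : nat) (G : gadget I N)
    (b : {ffun 'I_N -> bool}) (x z : {set I}) (i k : 'I_N) :
  core G x -> core G z -> uniq_term (term G) x i -> uniq_term (term G) z k ->
  b i == (e1 G \in x) -> (b k == (e1 G \in z)) (+) true -> ~~ (x \subset z).
Proof.
move=> /and3P[_ ex _] /and3P[_ ez _] xi zk bi bk; apply/negP => xz.
have ik : i = k := uniq_term_inj (subset_trans (uniq_term_sub xi) xz) zk.
move: bk; rewrite -ik (eqP bi) addbT.
move: ex ez (subsetP xz (e1 G)) (subsetP xz (e2 G)).
case: (e1 G \in x); case: (e2 G \in x); case: (e1 G \in z); case: (e2 G \in z) => //= _ _ H1 H2.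
all: by [have := H1 isT | have := H2 isT].
Qed.

(** Two points of the first kind share [e0]. Points of different kinds meet by the previous lemma.
    For two points of the second kind, each complement has fewer than [half G] control coordinates,
    too few to cover [ctl G] together. *)
Lemma hard_intersecting (I : finType) (N : nat) (G : gadget I N)
    (b : {ffun 'I_N -> bool}) (x y : {set I}) :
  #|ctl G| = (half G).*2 ->
  hard G true b x -> hard G true b y -> x :&: y != set0.
Proof.
move=> Ch; rewrite /hard => /orP[]/and3P[cx lx /existsP[i /andP[xi bi]]]
  /orP[]/and3P[cy ly /existsP[k /andP[yk bk]]].
- by apply/set0Pn; exists (e0 G); rewrite inE; case/and3P: cx => ->; case/and3P: cy => ->.
- have := hard_low_high_meet cx cy xi yk bi bk.
  by rewrite -disjoints_subset -setI_eq0.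
- have := hard_low_high_meet cy cx yk xi bk bi.
  by rewrite -disjoints_subset -setI_eq0 setIC.
- apply/negP => /eqP xy0.
  case/and3P: cx => _ _ /andP[_ cx]; case/and3P: cy => _ _ /andP[_ cy].
  have : #|ctl G| <= #|~: x :&: ctl G| + #|~: y :&: ctl G|.
    rewrite -cardsUI; apply: leq_trans (leq_addr _ _); apply: subset_leq_card.
    by rewrite -setIUl -setCI xy0 setC0 setTI.
  by rewrite Ch; lia.
Qed.

(* Flipping the bits of the terms seen through complements turns one family of
   functions into the other. *)
Lemma hard_flip (I : finType) (N : nat) (G : gadget I N) (Q : {set {set I}}) :
  (forall x y, x \in Q -> y \in Q -> ~~ conflict G x (~: y)) ->
  exists J : {ffun 'I_N -> bool}, forall (b : {ffun 'I_N -> bool}) x, x \in Q ->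
    hard G false b x = hard G true [ffun i => b i (+) J i] x.
Proof.
move=> nc.
exists [ffun i => [exists y in Q, [&& core G (~: y), high G (~: y) &
  uniq_term (term G) (~: y) i]]] => b x xQ.
rewrite /hard; congr orb.
  case cx: (core G x) => //=; case lx: (low G x) => //=.
  apply: eq_existsb => i; case xi: (uniq_term _ _ _) => //=.
  (* A term seen by a queried low point is not flipped: otherwise that point and the complement of
     another query would be in conflict. *)
  rewrite !ffunE [X in b i (+) X](_ : _ = false) ?addbF //.
  apply: contraNF (nc x x xQ xQ) => /exists_inP[y yQ /and3P[cy hy yi]].
  have := nc x y xQ yQ; rewrite /conflict cx lx cy hy /= => /negP[].
  by apply/existsP; exists i; rewrite subsetI !uniq_term_sub.
case cx: (core G (~: x)) => //=; case lx: (high G (~: x)) => //=.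
apply: eq_existsb => i; case xi: (uniq_term _ _ _) => //=.
rewrite !ffunE [X in b i (+) X](_ : _ = true).
  by case: (b i); case: (_ \in _).
by apply/exists_inP; exists x; rewrite // cx lx.
Qed.

(** * Probability of a conflict under a random permutation *)

Definition preim_set (I : finType) (pi : {perm I}) (x : {set I}) : {set I} :=
  [set l | pi l \in x].

Lemma preim_setC (I : finType) (pi : {perm I}) (x : {set I}) :
  preim_set pi (~: x) = ~: preim_set pi x.
Proof. by apply/setP => l; rewrite !inE. Qed.

(** Since [k * p >= h], Bernoulli gives [(1 - p / h) ^ k <= 1 / 2]; the [l]-th power is then
    taken. *)
Lemma exp_halving (h k p l : nat) :
  p <= h -> h <= k * p -> 0 < h -> 2 ^ l * (h - p) ^ (k * l) <= h ^ (k * l).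
Proof.
move=> ph hkp h0; rewrite !expnM -expnMn.
case: l => [|l]; first by rewrite !expn0.
rewrite leq_exp2r //.
have := bernoulli_lower (h - p) p k; rewrite subnK // => B.
have [->|hp0] := posnP (h - p).
  by case: k hkp {B} => [|k] hkp; [lia | rewrite exp0n // muln0].
rewrite -(@leq_pmul2l (h - p)) //; apply: leq_trans B.
rewrite mulnA mulnC leq_mul2l; apply/orP; right; nia.
Qed.

Lemma card_conflict (I : finType) (N : nat) (G : gadget I N) (x z : {set I})
    (l n h s d : nat) :
  l = gap G -> n = #|I| -> h = half G -> s = 64 * l * l -> 0 < l ->
  #|act G| = 4 * l ^ 2 -> #|ctl G| = h.*2 ->
  [disjoint act G & ctl G] -> n <= #|act G| + #|ctl G| + 4 -> h.*2 <= n ->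
  512 * l ^ 2 + 512 * l <= n -> s <= h ->
  2 * N * 'C(h, s) <= 'C(h.*2, s) ->
  (forall i, term G i \subset ctl G /\ #|term G i| = s) ->
  d = #|z :\: x| ->
  2 ^ l * #|[set pi : {perm I} | conflict G (preim_set pi x) (preim_set pi z)]|
    <= 2 * n`!.
Proof.
move=> lE nE hE sE l0 aE cE dis nac hn nl sh NC TP dE.
set bad := [set pi | _].
pose D := z :\: x.
pose Ab j := [set pi : {perm I} | j <= #|[set i in act G | pi i \in D]|].
(* Going from a low to a high point takes at least [l] new action coordinates, and they all come
   from [D]. *)
have badA : bad \subset Ab l.
  apply/subsetP => pi; rewrite !inE => /and5P[_ lx _ hz _].
  have : #|preim_set pi z :&: act G| <= #|preim_set pi x :&: act G| + #|[set i in act G | pi i \in D]|.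
    rewrite -cardsUI; apply: leq_trans (leq_addr _ _); apply: subset_leq_card.
    by apply/subsetP => i; rewrite !inE => /andP[-> ->]; case: (pi i \in x).
  by move: lx hz; rewrite /low /high -lE; lia.
(* With [#|act G| = 4 * l ^ 2], this is exactly the hypothesis of the tail bound at threshold
   [l]. *)
have [ld|ld] := leqP (32 * l * d) n.
  apply: leq_trans (_ : 2 ^ l * #|Ab l| <= _).
    by rewrite leq_mul2l subset_leq_card ?orbT.
  apply: leq_trans (_ : n`! <= _); last by rewrite leq_pmull.
  by rewrite nE; apply: card_perm_tail; rewrite -/D -dE -nE aE; nia.
(* If [act G] catches fewer than [j] elements of [D], about half of them, then [ctl G] catches at
   least [p], about a quarter: at most four coordinates lie elsewhere, and [d >= 16]. *)
pose j := uphalf d; pose p := uphalf (uphalf d).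
have dl : 16 <= d by nia.
have jl : l <= j by rewrite /j; nia.
have T1 : 2 ^ l * #|Ab j| <= n`!.
  apply: leq_trans (_ : 2 ^ j * #|Ab j| <= _); first by rewrite leq_mul2r leq_exp2l // jl orbT.
  by rewrite nE; apply: card_perm_tail; rewrite -/D -dE -nE aE /j; nia.
(* This event depends only on how many control coordinates go into [z] and into [D], so it is
   invariant under transpositions inside [ctl G]. It leaves at most [h - p] control coordinates for
   [x :&: z]. *)
pose E (pi : {perm I}) := (#|preim_set pi z :&: ctl G| < h) &&
  (p <= #|preim_set pi D :&: ctl G|).
pose B i := [set pi : {perm I} | E pi & [forall k in term G i, pi k \in x :&: z]].
have Ainv (u : {set I}) (pi : {perm I}) a b : a \in ctl G -> b \in ctl G ->
    #|preim_set (tperm a b * pi)%g u :&: ctl G| = #|preim_set pi u :&: ctl G|.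
  move=> aC bC; rewrite -(card_imset _ (@perm_inj _ (tperm a b))).
  apply: eq_card => i; apply/imsetP/idP.
    case=> k; rewrite !inE permM => /andP[ku kC] ->; rewrite ku /=.
    by case: tpermP => // ->.
  rewrite !inE => /andP[iu iC]; exists (tperm a b i); last by rewrite tpermK.
  by rewrite !inE permM tpermK iu /=; case: tpermP => // ->.
have dn : d <= n by rewrite dE nE max_card.
have ph : p <= h by move: nac nl; rewrite aE cE /p; lia.
have hk : h <= 64 * l * p.
  have : l * d <= l * (4 * p) by rewrite leq_mul2l /p; apply/orP; right; lia.
  lia.
have Bi i : #|B i| * (h.*2) ^_ s <= (h - p) ^_ s * n`!.
  have [TC Ts] := TP i.
  have := @card_perm_sub I (ctl G) (term G i) E (x :&: z) (h - p).
  rewrite Ts cE => H; apply: leq_trans (H _ _ TC) _.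
  - by move=> a b aC bC pi; rewrite /E !Ainv.
  - move=> pi /andP[zh pD].
    have : #|[set k in ctl G | pi k \in x :&: z]| + #|preim_set pi D :&: ctl G| <= #|preim_set pi z :&: ctl G|.
      rewrite -cardsUI [X in _ + X](_ : _ = 0) ?addn0; last first.
        by apply/eqP; rewrite cards_eq0; apply/eqP/setP => k; rewrite !inE; case: (pi k \in x); rewrite ?andbF.
      apply: subset_leq_card; apply/subsetP => k; rewrite !inE.
      by case: (k \in ctl G); case: (pi k \in z); rewrite ?andbF ?orbF.
    lia.
  rewrite leq_mul2l nE; apply/orP; right.
  by rewrite -card_perm_all max_card.
have badU : bad \subset Ab j :|: \bigcup_i B i.
  apply/subsetP => pi; rewrite !inE => /and5P[_ _ cz _ /existsP[i Ti]].
  case: leqP => //= Aj; apply/bigcupP; exists i => //.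
  rewrite inE /E hE; case/and3P: cz => _ _ /andP[_ ->] /=; apply/andP; split; last first.
    by apply/forall_inP => k /(subsetP Ti); rewrite !inE.
  have : #|preim_set pi D| <= #|[set i in act G | pi i \in D]| + #|preim_set pi D :&: ctl G| + 4.
    have rest : #|~: (act G :|: ctl G)| <= 4.
      have := cardsCs (~: (act G :|: ctl G)); rewrite setCK cardsU.
      by rewrite (_ : act G :&: ctl G = set0) ?cards0 -?nE; [lia | apply/eqP; rewrite setI_eq0].
    apply: leq_trans (_ : #|[set i in act G | pi i \in D] :|: (preim_set pi D :&: ctl G) :|: ~: (act G :|: ctl G)| <= _).
      apply: subset_leq_card; apply/subsetP => k; rewrite !inE.
      by case: (pi k \in x); case: (pi k \in z); case: (k \in act G); case: (k \in ctl G).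
    apply: leq_trans (leq_card_setU _ _) _.
    exact: leq_add (leq_card_setU _ _) rest.
  rewrite /preim_set card_preim_perm -dE; move: Aj; rewrite /j /p; lia.
pose S := \sum_i #|B i|.
apply: leq_trans (_ : 2 ^ l * (#|Ab j| + S) <= _).
  rewrite leq_mul2l; apply/orP; right.
  apply: leq_trans (subset_leq_card badU) _.
  apply: leq_trans (leq_card_setU _ _) _; rewrite leq_add2l.
  rewrite /S; elim/big_rec2: _ => [|i m X _ IH]; first by rewrite cards0.
  by apply: leq_trans (leq_card_setU _ _) _; rewrite leq_add2l.
rewrite mulnDr mul2n -addnn leq_add //.
have h0 : 0 < h by lia.
have f0 : 0 < (h.*2) ^_ s by rewrite ffact_gt0; lia.
have g0 : 0 < h ^ s by rewrite expn_gt0 h0.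
(* The union bound over the terms is [N (h - p) ^_ s / (h.*2) ^_ s]. Replacing [h - p] by [h] costs
   the factor [(1 - p / h) ^ s <= 2 ^ (- l)], and what remains is at most 1 by the choice of [N]. *)
have S1 : S * (h.*2) ^_ s <= N * ((h - p) ^_ s * n`!).
  rewrite /S big_distrl -[N in X in _ <= X]card_ord -sum_nat_const.
  exact: leq_sum.
have S2 := @ffact_ratio (h - p) h s (leq_subr _ _).
have S3 : 2 ^ l * (h - p) ^ s <= h ^ s.
  by rewrite sE; apply: exp_halving.
have S4 : N * h ^_ s <= (h.*2) ^_ s.
  rewrite -!bin_ffact mulnA leq_mul2r; apply/orP; right.
  by apply: leq_trans NC; rewrite -mulnA mul2n -addnn leq_addr.
rewrite -(@leq_pmul2r ((h.*2) ^_ s)) // -(@leq_pmul2r (h ^ s)) //.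
apply: (@leq_trans (2 ^ l * (N * ((h - p) ^_ s * n`!)) * h ^ s)).
  by rewrite leq_mul2r -mulnA leq_mul2l S1 !orbT.
rewrite (_ : _ * h ^ s = (h - p) ^_ s * h ^ s * (2 ^ l * N * n`!)); last by ring.
apply: (leq_trans (leq_mul S2 (leqnn _))).
rewrite (_ : _ * _ = 2 ^ l * (h - p) ^ s * (N * h ^_ s) * n`!); last by ring.
rewrite (_ : n`! * _ * _ = h ^ s * (h.*2) ^_ s * n`!); last by ring.
by rewrite leq_mul2r leq_mul ?orbT.
Qed.

(** * Distance from intersecting functions in the no case *)

Lemma sum_card_fibers_leq (S T : finType) (X : {set S}) (U : {set T}) (f : S -> T) :
  \sum_(c in U) #|[set x in X | f x == c]| <= #|X|.
Proof.
rewrite (eq_bigr (fun c => \sum_(x in X) (f x == c : nat))); last first.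
  move=> c _; rewrite -sum1_card big_mkcond [RHS]big_mkcond.
  by apply: eq_bigr => x _; rewrite inE; case: (x \in X); case: eqP.
rewrite exchange_big /= -sum1_card; apply: leq_sum => x _.
case fU: (f x \in U); last first.
  by rewrite big1 // => c cU; case: eqP => // fc; rewrite fc cU in fU.
by rewrite (bigD1 (f x)) //= eqxx big1 // => c /andP[_]; rewrite eq_sym => /negbTE ->.
Qed.

Definition good_middle (I : finType) (N : nat) (G : gadget I N) : {set {set I}} :=
  [set c : {set I} | [&& c \subset ctl G, half G - width G <= #|c| < half G &
    [exists i, uniq_term (term G) c i]]].

Definition low_sets (I : finType) (N : nat) (G : gadget I N) : {set {set I}} :=
  [set u : {set I} | u \subset act G & #|u|.*2 + gap G <= #|act G|].

(** For each good control part [c], the function accepts [glue c u] for [u] low and [~: glue c v]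
    for [v] high. When [u] is included in [v] these two sets are disjoint, so [g] rejects one of
    them. The rejected points thus form a vertex cover, for each [c] separately. *)
Lemma hard_far (I : finType) (N : nat) (G : gadget I N)
    (b : {ffun 'I_N -> bool}) (g : pred {set I}) :
  [disjoint act G & ctl G] ->
  [&& e0 G \notin act G :|: ctl G, e1 G \notin act G :|: ctl G & e2 G \notin act G :|: ctl G] ->
  uniq [:: e0 G; e1 G; e2 G] ->
  (forall i, term G i \subset ctl G) ->
  (forall x y, g x -> g y -> x :&: y != set0) ->
  #|good_middle G| * #|low_sets G| <= #|[set x | hard G false b x != g x]|.
Proof.
case: G => A C a0 a1 a2 h w l T; rewrite /good_middle /low_sets /=.
move=> dis /and3P[a0n a1n a2n] /= au TC gI.
set U := [set c : {set I} | _]; set L := [set u : {set I} | _].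
(* On a good [c], [bt c] is the bit of its only term, and [pat c] is the pattern of the extra
   coordinates that this bit accepts. *)
pose bt (c : {set I}) := [exists i, uniq_term T c i && b i].
pose pat (c : {set I}) := [set x in (if bt c then [:: a0; a1] else [:: a0; a2])].
pose glue (c u : {set I}) := c :|: u :|: pat c.
have a0A : a0 \in A = false by apply: contraNF a0n; rewrite inE => ->.
have a1A : a1 \in A = false by apply: contraNF a1n; rewrite inE => ->.
have a2A : a2 \in A = false by apply: contraNF a2n; rewrite inE => ->.
have a0C : a0 \in C = false by apply: contraNF a0n; rewrite inE => ->; rewrite orbT.
have a1C : a1 \in C = false by apply: contraNF a1n; rewrite inE => ->; rewrite orbT.
have a2C : a2 \in C = false by apply: contraNF a2n; rewrite inE => ->; rewrite orbT.
have patA c x : x \in A -> x \in pat c = false.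
  move=> xA; apply/negP; rewrite inE.
  by case: (bt c); rewrite !inE => /orP[]/eqP xe; move: xA; rewrite xe ?a0A ?a1A ?a2A.
have patC c x : x \in C -> x \in pat c = false.
  move=> xC; apply/negP; rewrite inE.
  by case: (bt c); rewrite !inE => /orP[]/eqP xe; move: xC; rewrite xe ?a0C ?a1C ?a2C.
have AC x : x \in A -> x \in C = false.
  exact: disjointFr dis.
have glueC (c u : {set I}) : c \subset C -> u \subset A -> glue c u :&: C = c.
  move=> cC uA; apply/setP => x; rewrite in_setI /glue !in_setU.
  case xC: (x \in C); last by rewrite andbF; apply/esym/(contraFF _ xC)/(subsetP cC).
  rewrite patC // orbF andbT.
  case xu: (x \in u); rewrite ?orbF //.
  by have := AC x (subsetP uA x xu); rewrite xC.
have glueA (c u : {set I}) : c \subset C -> u \subset A -> glue c u :&: A = u.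
  move=> cC uA; apply/setP => x; rewrite in_setI /glue !in_setU.
  case xA: (x \in A); last by rewrite andbF; apply/esym/(contraFF _ xA)/(subsetP uA).
  rewrite patA // orbF andbT.
  case xc: (x \in c) => //=.
  by have := AC x xA; rewrite (subsetP cC x xc).
have glue_e (c u : {set I}) : c \subset C -> u \subset A ->
    [/\ a0 \in glue c u, (a1 \in glue c u) = bt c & (a2 \in glue c u) = ~~ bt c].
  move=> cC uA.
  have nin a : a \in A = false -> a \in C = false -> (a \in glue c u) = (a \in pat c).
    move=> aA aC; rewrite /glue !in_setU.
    have -> : a \in c = false by apply/(contraFF _ aC)/(subsetP cC).
    by have -> : a \in u = false by apply/(contraFF _ aA)/(subsetP uA).
  move: au; rewrite !nin // !inE => /and3P[/norP[/negbTE n01 /negbTE n02] /negbTE n12 _].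
  have [n10 n20 n21] : [/\ (a1 == a0) = false, (a2 == a0) = false & (a2 == a1) = false].
    by rewrite ![_ == a0]eq_sym [a2 == _]eq_sym.
  by case: (bt c); split; rewrite !inE ?eqxx ?n12 ?n10 ?n20 ?n21 ?orbT.
have glueT (c u : {set I}) i : c \subset C -> u \subset A -> uniq_term T (glue c u) i = uniq_term T c i.
  move=> cC uA; apply: eq_forallb => j; congr (_ == _).
  by rewrite -[in RHS](glueC c u) // subsetI TC andbT.
have btE c i : uniq_term T c i -> bt c = b i.
  move=> ci; apply/existsP/idP => [[k /andP[ck]]|bi]; last by exists i; rewrite ci.
  by rewrite (uniq_term_inj (uniq_term_sub ck) ci).
have UP c : c \in U -> [/\ c \subset C, h - w <= #|c| < h & exists i, uniq_term T c i].
  by rewrite inE => /and3P[? ? /existsP].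
pose G := Gadget A C a0 a1 a2 h w l T.
have coreG (c u : {set I}) : c \in U -> u \subset A -> core G (glue c u).
  move=> /UP[cC cm _] uA; have [g0 g1 g2] := glue_e c u cC uA.
  by rewrite /core /= g0 g1 g2 glueC // cm andbT; case: (bt c).
have hardlow (c u : {set I}) : c \in U -> u \subset A -> #|u|.*2 + l <= #|A| -> hard G false b (glue c u).
  move=> cU uA ul; have [cC cm [i ci]] := UP c cU; have [g0 g1 g2] := glue_e c u cC uA.
  rewrite /hard (coreG _ _ cU uA) /low /= glueA // ul /=; apply/orP; left.
  by apply/existsP; exists i; rewrite glueT // ci g1 (btE _ _ ci) /=.
have hardhigh (c v : {set I}) : c \in U -> v \subset A -> #|A| + l <= #|v|.*2 -> hard G false b (~: glue c v).
  move=> cU uA ul; have [cC cm [i ci]] := UP c cU; have [g0 g1 g2] := glue_e c v cC uA.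
  rewrite /hard setCK (coreG _ _ cU uA) /high /= glueA // ul /=; apply/orP; right.
  by apply/existsP; exists i; rewrite glueT // ci g1 (btE _ _ ci) eqxx.
set D := [set x | _].
(* Glued points contain [a0] and their complements do not, so the two sides of the cover are counted
   in disjoint parts of [D]. *)
pose D0 := [set x in D | a0 \in x]; pose D1 := [set x in D | a0 \notin x].
have DD : #|D| = #|D0| + #|D1|.
  rewrite -(cardsID [set x : {set I} | a0 \in x] D); congr (_ + _); apply: eq_card => x.
    by rewrite !inE.
  by rewrite !inE andbC.
rewrite DD.
have F0 := sum_card_fibers_leq D0 U (fun x => x :&: C).
have F1 := sum_card_fibers_leq D1 U (fun x => ~: x :&: C).
apply: leq_trans (leq_add F0 F1); rewrite -big_split /= -sum_nat_const.
apply: leq_sum => c cU; have [cC cm [i ci]] := UP c cU.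
apply: leq_trans (_ : _ <= #|[set u : {set I} | [&& u \subset A, #|u|.*2 + l <= #|A| & ~~ g (glue c u)]]|
    + #|[set v : {set I} | [&& v \subset A, #|A| + l <= #|v|.*2 & ~~ g (~: glue c v)]]|) _.
  apply: (@low_high_vertex_cover I A (fun u => ~~ g (glue c u)) (fun v => ~~ g (~: glue c v)) l) => u v uv vA _ _.
  rewrite -negb_and; apply/negP => /andP[g1 g2].
  have := gI _ _ g1 g2; rewrite -setDE setD_eq0 => /negP[].
  by apply: setSU; apply: setUS.
apply: leq_add.
  rewrite -(@card_in_imset _ _ (glue c)); last first.
    move=> u v; rewrite !inE => /andP[uA _] /andP[vA _] uv.
    by rewrite -(glueA c u) // uv glueA.
  apply: subset_leq_card; apply/subsetP => _ /imsetP[u + ->].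
  rewrite in_set => /and3P[uA ul /negbTE gu].
  have [g0 _ _] := glue_e c u cC uA.
  by rewrite in_set glueC // eqxx andbT in_set g0 andbT in_set gu -/G hardlow.
rewrite -(@card_in_imset _ _ (fun v => ~: glue c v)); last first.
  move=> u v; rewrite !inE => /andP[uA _] /andP[vA _] /setC_inj uv.
  by rewrite -(glueA c u) // uv glueA.
apply: subset_leq_card; apply/subsetP => _ /imsetP[u + ->].
rewrite in_set => /and3P[uA ul /negbTE gu].
have [g0 _ _] := glue_e c u cC uA.
by rewrite in_set setCK glueC // eqxx andbT in_set in_setC negbK g0 andbT in_set gu -/G hardhigh.
Qed.

(** * Lower bound for testers *)

Definition support (n : nat) (x : cube n) : {set 'I_n} := [set i | x i].

Definition hard_fun (n N : nat) (G : gadget 'I_n N) (t : bool)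
    (pb : {perm 'I_n} * {ffun 'I_N -> bool}) (x : cube n) : bool :=
  hard G t pb.2 (preim_set pb.1 (support x)).

Lemma hard_fun_intersecting (n N : nat) (G : gadget 'I_n N) pb :
  #|ctl G| = (half G).*2 -> intersecting (hard_fun G true pb).
Proof.
move=> Ch x y fx fy; have /set0Pn[i] := hard_intersecting Ch fx fy.
by rewrite !inE => xy; exists (pb.1 i).
Qed.

Lemma hard_fun_diff (n N : nat) (G : gadget 'I_n N) pb (g : cube n -> bool) :
  [disjoint act G & ctl G] ->
  [&& e0 G \notin act G :|: ctl G, e1 G \notin act G :|: ctl G & e2 G \notin act G :|: ctl G] ->
  uniq [:: e0 G; e1 G; e2 G] ->
  (forall i, term G i \subset ctl G) ->
  intersecting g ->
  #|good_middle G| * #|low_sets G| <= #|[set x | hard_fun G false pb x != g x]|.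
Proof.
move=> dis en eu TC gI; case: pb => pi b.
pose pt (X : {set 'I_n}) : cube n := [ffun i => (pi^-1)%g i \in X].
have ptK X : preim_set pi (support (pt X)) = X.
  by apply/setP => i; rewrite !inE ffunE permK.
have ptI : injective pt by move=> X Y /(congr1 (fun x => preim_set pi (support x))); rewrite !ptK.
apply: leq_trans (@hard_far _ _ G b (fun X => g (pt X)) dis en eu TC _) _.
  move=> x y /gI /[apply] -[i]; rewrite !ffunE => xy.
  by apply/set0Pn; exists ((pi^-1)%g i); rewrite inE.
have <- := card_imset (mem [set x | hard G false b x != g (pt x)]) ptI.
apply: subset_leq_card.
by apply/subsetP => _ /imsetP[X + ->]; rewrite !inE /hard_fun /= ptK.
Qed.

Definition bad_perms (n N q : nat) (G : gadget 'I_n N) (D : det_tester n q) :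
    {set {perm 'I_n}} :=
  [set pi | [exists i, exists j, conflict G (preim_set pi (support (tnth D.1 i)))
     (~: preim_set pi (support (tnth D.1 j)))]].

(** For a permutation without conflict, an involution of the bit vectors makes the two functions
    agree on all queries, so acceptance counts coincide. A bad permutation contributes at most
    [2 ^ N] bit vectors. *)
Lemma accepts_hard_fun (n N q : nat) (G : gadget 'I_n N) (D : det_tester n q) :
  #|[set pb | accepts D (hard_fun G true pb)]| <=
    #|[set pb | accepts D (hard_fun G false pb)]| + #|bad_perms G D| * 2 ^ N.
Proof.
have cntE t : #|[set pb | accepts D (hard_fun G t pb)]| =
    \sum_(pi : {perm 'I_n}) \sum_(b : {ffun 'I_N -> bool}) accepts D (hard_fun G t (pi, b)).
  rewrite pair_big /= -sum1_card big_mkcond; apply: eq_bigr => -[pi b] _.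
  by rewrite inE; case: (accepts _ _).
rewrite !cntE -sum_nat_const [X in _ + X]big_mkcond -big_split /=.
apply: leq_sum => pi _; case: ifP => [_|good].
  apply: leq_trans (leq_addl _ _).
  apply: leq_trans (_ : _ <= \sum_(b : {ffun 'I_N -> bool}) 1) _.
    by apply: leq_sum => b _; apply: leq_b1.
  by rewrite sum1_card card_ffun card_bool card_ord.
rewrite addn0.
pose Q := [set preim_set pi (support x) | x in D.1].
have [J HJ] : exists J : {ffun 'I_N -> bool}, forall (b : {ffun 'I_N -> bool}) x, x \in Q ->
    hard G false b x = hard G true [ffun i => b i (+) J i] x.
  apply: hard_flip => _ _ /imsetP[x /tnthP[i ->] ->] /imsetP[y /tnthP[j ->] ->].
  apply: contraFN good => cf; rewrite inE.
  by apply/existsP; exists i; apply/existsP; exists j.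
pose flip (b : {ffun 'I_N -> bool}) : {ffun 'I_N -> bool} := [ffun i => b i (+) J i].
have flipK : involutive flip by move=> b; apply/ffunP => i; rewrite !ffunE addbK.
rewrite (reindex_inj (can_inj flipK)) /=; apply: leq_sum => b _.
apply: eq_leq; congr (nat_of_bool _); rewrite /accepts; congr (D.2 _).
apply: eq_from_tnth => i; rewrite !tnth_map /hard_fun /=.
by rewrite HJ //; apply: imset_f; apply: mem_tnth.
Qed.

Lemma card_bad_perms (n N q l : nat) (G : gadget 'I_n N) (D : det_tester n q) :
  (forall x z, 2 ^ l * #|[set pi : {perm 'I_n} | conflict G (preim_set pi x) (preim_set pi z)]|
    <= 2 * n`!) ->
  2 ^ l * #|bad_perms G D| <= 2 * q ^ 2 * n`!.
Proof.
move=> H; pose B i j := [set pi : {perm 'I_n} |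
  conflict G (preim_set pi (support (tnth D.1 i))) (preim_set pi (~: support (tnth D.1 j)))].
have sub : #|bad_perms G D| <= \sum_(i < q) \sum_(j < q) #|B i j|.
  rewrite (eq_bigr (fun i : 'I_q => \sum_(pi : {perm 'I_n}) \sum_(j < q) (pi \in B i j : nat))); last first.
    move=> i _; rewrite exchange_big; apply: eq_bigr => j _.
    by rewrite -sum1_card big_mkcond.
  rewrite exchange_big -sum1_card big_mkcond; apply: leq_sum => pi _ /=.
  rewrite inE; case: existsP => // -[i /existsP[j cf]].
  by rewrite (bigD1 i) //= (bigD1 j) //= inE preim_setC cf.
apply: leq_trans (leq_mul (leqnn _) sub) _.
rewrite big_distrr /=.
apply: leq_trans (_ : _ <= \sum_(i < q) \sum_(j < q) 2 * n`!) _.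
  by apply: leq_sum => i _; rewrite big_distrr; apply: leq_sum => j _; apply: H.
by rewrite !sum_nat_const !card_ord; apply: eq_leq; ring.
Qed.

(** * Choice of the parameters *)

Lemma card_ord_range (n i j : nat) :
  i <= j -> j <= n -> #|[set k : 'I_n | i <= k < j]| = j - i.
Proof.
move=> ij jn; rewrite cardsE -sum1_card -(big_mkord (fun k => i <= k < j) (fun _ => 1)).
rewrite -[RHS]muln1 -sum_nat_const_nat (@big_nat_widenl _ _ _ i 0) // (@big_nat_widen _ _ _ 0 j n) //.
Qed.

(** The ratio of the coefficients is at least [(1 - w / (h - s)) ^ s], hence at least
    [1 - s w / (h - s) >= 1 / 2]. So one scale [t] serves the whole window in [exists_terms]. *)
Lemma leq_bin_half (h w s c : nat) :
  2 * (s * w) + s < h -> h - w <= c -> 'C(h, s) <= 2 * 'C(c, s).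
Proof.
move=> hs hc; have [->|s0] := posnP s; first by rewrite !bin0.
have wh : w + s < h by nia.
have H1 : h ^_ s <= 2 * (h - w) ^_ s.
  have p0 : 0 < (h - s) ^ s by rewrite expn_gt0; lia.
  have E1 := @ffact_ratio_shift (h - w) h s ltac:(lia) (leq_subr _ _).
  have E2 := @bernoulli_upper (h - s) w s ltac:(lia).
  have E3 : (h - s) ^ s <= 2 * (h - s - w) ^ s.
    rewrite -(@leq_pmul2l (h - s)); last by lia.
    apply: leq_trans (_ : 2 * ((h - s) ^ s * (h - s - s * w)) <= _).
      by rewrite mulnC mulnCA leq_mul2l; apply/orP; right; lia.
    by rewrite [X in _ <= X]mulnCA leq_mul2l E2.
  rewrite -(@leq_pmul2r ((h - s) ^ s)) // -mulnA.
  apply: leq_trans (_ : 2 * ((h - w - s) ^ s * h ^_ s) <= _); last by rewrite leq_mul2l E1.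
  by rewrite mulnA [h - w - s]subnAC mulnC leq_mul2r E3 orbT.
rewrite -(@leq_pmul2r s`!) ?fact_gt0 // -mulnA !bin_ffact.
by apply: leq_trans H1 _; rewrite leq_mul2l leq_ffact2.
Qed.

Lemma double_bin_leq (h s : nat) : 0 < s -> 2 * 'C(h, s) <= 'C(h.*2, s).
Proof.
case: s => // s _; rewrite -(@leq_pmul2r s.+1`!) ?fact_gt0 // -mulnA !bin_ffact.
rewrite !ffactnS mulnA mul2n leq_mul2l; apply/orP; right.
by apply: leq_ffact2; lia.
Qed.

(** Here [y] stands for [eps * sqrt n], and the last conclusion is the squared form of distance at
    least [y / sqrt n]. The bound on [y * r ^ 2] keeps [s * w] small against [h]; the bound on [y]
    keeps the window inside the large central layers. *)
Lemma exists_gadget (K n y r : nat) :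
  K = 128 * 32 -> 0 < y -> 0 < r ->
  K ^ 2 * (y * r ^ 2) <= n -> 16 * (K * y) ^ 2 <= n ->
  exists N (G : gadget 'I_n N),
    [/\ #|ctl G| = (half G).*2,
      (forall x z, 2 ^ r.*2 * #|[set pi : {perm 'I_n} | conflict G (preim_set pi x) (preim_set pi z)]|
        <= 2 * n`!) &
      forall pb (g : cube n -> bool), intersecting g ->
        y ^ 2 * 4 ^ n <= n * #|[set x | hard_fun G false pb x != g x]| ^ 2].
Proof.
move=> KE y0 r0 nyr ny.
pose P := y * r ^ 2; pose R := r ^ 2; pose w := K * y.
have RP : R <= P by rewrite /P leq_pmull.
have rR : r <= R by rewrite /R; nia.
have K0 : 4000 <= K by rewrite KE.
have KP : 4000 * P <= K * P by rewrite leq_mul2r K0 orbT.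
have KKP : 4000 * (K * P) <= K * (K * P) by rewrite leq_mul2r K0 orbT.
have nP : K * (K * P) <= n by rewrite mulnA mulnn.
have P0 : 0 < P by apply: leq_trans RP; rewrite expn_gt0 r0.
pose l := r.*2; pose a := 4 * l ^ 2; pose s := 64 * l * l.
have aR : a = 16 * R by rewrite /a /l /R -mul2n; ring.
have sR : s = 256 * R by rewrite /s /l /R -mul2n; ring.
have swP : s * w = 256 * (K * P) by rewrite sR /w /R /P; ring.
have lR : l ^ 2 = 4 * R by rewrite /l /R -mul2n; ring.
have nw : 16 * w ^ 2 <= n by [].
have wE : w = K * y by [].
clearbody P w; clear nyr ny; clearbody R.
(* Three coordinates are reserved for [e0], [e1], [e2]; halving may waste one more, hence the 4 in
   [nh]. *)
pose h := (n - a - 3)./2.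
have h2n : a + h.*2 + 3 <= n by rewrite /h; lia.
have nh : n <= a + h.*2 + 4 by rewrite /h; lia.
clearbody h.
have hw : 2 * w ^ 2 <= h by lia.
have hsw : 2 * (s * w) + s < h by lia.
have sh : s <= h by lia.
have s0 : 0 < s by lia.
pose A := [set k : 'I_n | 0 <= k < a].
pose C := [set k : 'I_n | a <= k < a + h.*2].
have Aa : #|A| = a by rewrite card_ord_range ?subn0 //; lia.
have Cc : #|C| = h.*2 by rewrite card_ord_range ?addKn //; lia.
have dis : [disjoint A & C].
  by rewrite -setI_eq0; apply/eqP/setP => k; rewrite !inE; lia.
pose t := 'C(h, s).
have t0 : 0 < t by rewrite bin_gt0.
(* The expected number [N * t / 'C(h.*2, s)] of terms inside a set of size [h] then lies between
   [1 / 4] and [1 / 2]. *)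
pose N := 'C(h.*2, s) %/ (2 * t).
have NS : 2 * N * t <= 'C(#|C|, s).
  by rewrite Cc [2 * N]mulnC -mulnA leq_divM.
have N0 : 0 < N by rewrite divn_gt0 ?muln_gt0 ?t0 // double_bin_leq.
have SN : 'C(#|C|, s) <= 4 * N * t.
  rewrite Cc; have := @ltn_ceil 'C(h.*2, s) (2 * t); rewrite muln_gt0 t0 -/N => /(_ isT) /ltnW H.
  by apply: leq_trans H _; rewrite mulnA leq_mul2r; apply/orP; right; lia.
pose Mid := [set c : {set 'I_n} | c \subset C & h - w <= #|c| < h].
have [||T [TP Tgood]] := @exists_terms 'I_n C Mid s N t _ _ NS SN.
- by rewrite Cc bin_gt0; lia.
- move=> c; rewrite inE => /and3P[cC ch1 ch2]; split=> //; first by apply: leq_bin2l; lia.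
  exact: leq_bin_half ch1.
have i0 : a + h.*2 < n by lia.
have i1 : a + h.*2 + 1 < n by lia.
have i2 : a + h.*2 + 2 < n by lia.
pose G := Gadget A C (Ordinal i0) (Ordinal i1) (Ordinal i2) h w l T.
exists N, G; split => //.
- move=> x z.
  apply: (@card_conflict 'I_n N G x z l n h s #|z :\: x|) => //=.
  + by rewrite card_ord.
  + by rewrite /l; lia.
  + by rewrite Aa Cc; lia.
  + by lia.
  + by rewrite lR /l; lia.
  + by rewrite -/t -Cc.
- move=> pb g gI.
  have := @hard_fun_diff n N G pb g dis _ _ _ gI.
  set Delta := #|[set x | _ != _]| => H.
  have {H} D1 : #|good_middle G| * #|low_sets G| <= Delta.
    apply: H; rewrite /=.
    + by rewrite !inE /=; lia.
    + by rewrite !inE -!val_eqE /=; lia.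
    + by move=> i; have [] := TP i.
  have D2 : #|Mid| <= 16 * #|good_middle G|.
    apply: leq_trans Tgood _; rewrite leq_mul2l /=; apply: subset_leq_card.
    by apply/subsetP => c; rewrite !inE => /andP[/andP[-> ->] ->].
  have D3 : 2 ^ a <= 4 * #|low_sets G|.
    by rewrite -Aa; apply: card_low_lower.
  have D4 : w * 'C(h.*2, h) <= 2 * #|Mid| by apply: card_window_lower.
  have D5 := @bin_central_lower h ltac:(lia).
  (* The factor 128 of [K] pays for the losses 2, 16 and 4 in [D4], [D2] and [D3]; the factor 32 is
     kept for [D7], where [32 ^ 2 = 4 * 4 ^ 4] covers the leading 4 and the four leftover
     coordinates. *)
  have D6 : 32 * (w * 'C(h.*2, h) * 2 ^ a) <= K * Delta.
    apply: leq_trans (_ : _ <= 32 * (128 * (#|good_middle G| * #|low_sets G|))) _; last first.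
      by rewrite mulnA [32 * 128]mulnC -KE leq_mul2l D1 orbT.
    rewrite leq_mul2l; apply/orP; right.
    rewrite (_ : 128 * _ = (2 * (16 * #|good_middle G|)) * (4 * #|low_sets G|)); last by ring.
    apply: leq_mul => //; apply: leq_trans D4 _.
    by rewrite leq_mul2l D2.
  have D7 : 4 * (w ^ 2 * 4 ^ n) <= 2 * n * (K * Delta) ^ 2.
    apply: leq_trans (_ : 4 * (w ^ 2 * 4 ^ (a + h.*2 + 4)) <= _).
      by rewrite !leq_mul2l leq_exp2l // nh !orbT.
    apply: leq_trans (_ : (4 * h) * (K * Delta) ^ 2 <= _); last first.
      by rewrite leq_mul2r; apply/orP; right; lia.
    apply: leq_trans (_ : 4 * h * (32 * (w * 'C(h.*2, h) * 2 ^ a)) ^ 2 <= _); last first.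
      by rewrite leq_mul2l leq_sqr D6 orbT.
    rewrite (expnD 4 (a + h.*2) 4) (expnD 4 a) -mul2n [4 ^ (2 * h)]expnM -[4 ^ 2]/16 mul2n.
    have -> : 4 ^ a = (2 ^ a) ^ 2 by rewrite -expnM mulnC expnM.
    move: (2 ^ a) (16 ^ h) D5 => X Y D5.
    rewrite (_ : 4 * _ = 1024 * w ^ 2 * X ^ 2 * Y); last by ring.
    apply: leq_trans (leq_mul (leqnn _) D5) _.
    apply: eq_leq; ring.
  have K2 : 0 < 2 * K ^ 2 by rewrite muln_gt0 expn_gt0; lia.
  rewrite -(@leq_pmul2l (2 * K ^ 2)) //.
  rewrite (_ : 2 * K ^ 2 * (n * _) = 2 * n * (K * Delta) ^ 2); last by rewrite expnMn; ring.
  apply: leq_trans D7; rewrite wE expnMn -!mulnA !mulnA !leq_mul2r; lia.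
Qed.

(** * From counting to probabilities and real parameters *)

Import Order.TTheory GRing.Theory Num.Theory.
Local Open Scope ring_scope.

Lemma pr_accept_reject (R : realType) (n q : nat) (A : tester R n q) f :
  pr_accept A f + pr_reject A f = 1.
Proof. by rewrite -(law_sum1 A) [RHS](bigID (fun D => accepts D f)). Qed.

Lemma sum_pr_accept (R : realType) (n N q : nat) (G : gadget 'I_n N) (t : bool)
    (A : tester R n q) :
  \sum_pb pr_accept A (hard_fun G t pb) =
  \sum_D law A D * #|[set pb | accepts D (hard_fun G t pb)]|%:R.
Proof.
rewrite (eq_bigr (fun pb => \sum_D if accepts D (hard_fun G t pb) then law A D else 0)); last first.
  by move=> pb _; rewrite /pr_accept big_mkcond.
rewrite exchange_big; apply: eq_bigr => D _ /=.
rewrite mulr_natr -sumr_const [RHS]big_mkcond.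
by apply: eq_bigr => pb _; rewrite inE.
Qed.

(** Averaged over permutations and bits, acceptance is at least [2 / 3] in the yes case and at most
    [1 / 3] in the no case, while the union bound over pairs of queries limits the difference to
    [2 q ^ 2 / 2 ^ l]. *)
Lemma queries_lower_bound (R : realType) (n N q l : nat) (eps : R)
    (G : gadget 'I_n N) (A : tester R n q) :
  #|ctl G| = (half G).*2 ->
  (forall pb, far_from_intersecting eps (hard_fun G false pb)) ->
  (forall x z, (2 ^ l * #|[set pi : {perm 'I_n} | conflict G (preim_set pi x) (preim_set pi z)]|
    <= 2 * n`!)%N) ->
  tests_intersecting eps A ->
  (2 ^ l <= 6 * q ^ 2)%N.
Proof.
move=> Ch far conf [tyes tno].
pose M : R := (n`! * 2 ^ N)%:R.
have M0 : 0 < M by rewrite ltr0n muln_gt0 fact_gt0 expn_gt0.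
have cardpb : #|{: {perm 'I_n} * {ffun 'I_N -> bool}}| = (n`! * 2 ^ N)%N.
  by rewrite card_prod card_perm_all card_ffun card_bool !card_ord.
have yes : 2 / 3 * M <= \sum_pb pr_accept A (hard_fun G true pb).
  rewrite mulr_natr -cardpb -sumr_const; apply: ler_sum => pb _.
  by apply: tyes; apply: hard_fun_intersecting.
have no : \sum_pb pr_accept A (hard_fun G false pb) <= 1 / 3 * M.
  rewrite mulr_natr -cardpb -sumr_const; apply: ler_sum => pb _.
  have := tno _ (far pb); have := pr_accept_reject A (hard_fun G false pb); lra.
have diff : (2 ^ l)%:R * \sum_pb pr_accept A (hard_fun G true pb) <=
    (2 ^ l)%:R * \sum_pb pr_accept A (hard_fun G false pb) + (2 * q ^ 2)%:R * M.
  rewrite !sum_pr_accept !mulr_sumr.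
  have -> : (2 * q ^ 2)%:R * M = \sum_D law A D * ((2 * q ^ 2)%:R * M).
    by rewrite -mulr_suml law_sum1 mul1r.
  rewrite -big_split /=.
  apply: ler_sum => D _.
  rewrite mulrCA [(2 ^ l)%:R * (_ * _)]mulrCA -mulrDr; apply: ler_wpM2l (law_ge0 _ _) _ _ _.
  rewrite /M -!natrM -natrD ler_nat.
  apply: leq_trans (leq_mul (leqnn _) (accepts_hard_fun G D)) _.
  rewrite mulnDr leq_add2l mulnA [X in (_ <= X)%N]mulnA leq_mul2r.
  by rewrite card_bad_perms ?orbT.
have : (2 ^ l)%:R * (1 / 3 * M) <= (2 * q ^ 2)%:R * M.
  have l0 : 0 <= (2 ^ l)%:R :> R by rewrite ler0n.
  have := ler_wpM2l l0 yes; have := ler_wpM2l l0 no; lra.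
rewrite mulrA ler_pM2r // => H.
rewrite -(@ler_nat R); have -> : (6 * q ^ 2 = 3 * (2 * q ^ 2))%N by lia.
rewrite [X in _ <= X]natrM; lra.
Qed.

Lemma far_of_diff (R : realType) (n y : nat) (eps : R) (f : cube n -> bool) :
  (0 < n)%N -> eps * Num.sqrt n%:R <= y%:R ->
  (forall g : cube n -> bool, intersecting g ->
     (y ^ 2 * 4 ^ n <= n * #|[set x | f x != g x]| ^ 2)%N) ->
  far_from_intersecting eps f.
Proof.
move=> n0 ey H g /H; rewrite /dist; set D := #|[set x | _ != _]| => yD.
have -> : #|{: cube n}| = (2 ^ n)%N by rewrite card_ffun card_bool card_ord.
have sn0 : 0 < Num.sqrt n%:R :> R by rewrite sqrtr_gt0 ltr0n.
rewrite ler_pdivlMr ?ltr0n ?expn_gt0 // -(ler_pM2r sn0) mulrAC.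
apply: le_trans (_ : y%:R * (2 ^ n)%:R <= _).
  by rewrite ler_wpM2r // ler0n.
rewrite -(@ler_pXn2r _ 2) // ?nnegrE ?mulr_ge0 ?ler0n ?(ltW sn0) //.
rewrite -natrM -natrX [X in _ <= X]exprMn sqr_sqrtr ?ler0n // -natrX -natrM ler_nat.
by rewrite expnMn [((2 ^ n) ^ 2)%N]expnAC [X in (_ <= X)%N]mulnC.
Qed.

(** The gap is [r.*2], so a spare factor [2 ^ r >= 8] is available to absorb the constant 6. *)
Lemma queries_nat_bound (R : realType) (K n y r q : nat) (eps : R) (A : tester R n q) :
  (K = 128 * 32)%N -> (0 < n)%N -> (0 < y)%N -> (3 <= r)%N ->
  (K ^ 2 * (y * r ^ 2) <= n)%N -> (16 * (K * y) ^ 2 <= n)%N ->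
  eps * Num.sqrt n%:R <= y%:R ->
  tests_intersecting eps A -> (2 ^ r <= q ^ 2)%N.
Proof.
move=> KE n0 y0 r3 nyr ny ey At.
have [|N [G [Ch conf far]]] := exists_gadget KE y0 _ nyr ny; first by lia.
have H : (2 ^ r.*2 <= 6 * q ^ 2)%N.
  apply: (queries_lower_bound Ch _ conf At) => pb.
  exact: far_of_diff n0 ey (far pb).
have r8 : (8 <= 2 ^ r)%N by rewrite -[8%N]/(2 ^ 3)%N leq_exp2l.
have : (8 * 2 ^ r <= 6 * q ^ 2)%N.
  by apply: leq_trans H; rewrite -addnn expnD leq_mul2r r8 orbT.
lia.
Qed.

Theorem theorem1p2 (R : realType) :
  exists c : R, 0 < c /\
  exists a : R, 0 < a /\
  forall (n : nat) (eps : R),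
    (0 < n)%N -> 1 / Num.sqrt n%:R <= eps -> eps < c ->
    forall (q : nat) (A : tester R n q),
      tests_intersecting eps A ->
      2 `^ (a * (n%:R `^ (1 / 4) / Num.sqrt eps)) <= q%:R.
Proof.
have [K KE] : exists K, (K = 128 * 32)%N by exists (128 * 32)%N.
have K1 : (1 <= K)%N by rewrite KE.
pose k : R := K%:R.
have k1 : 1 <= k by rewrite /k ler1n.
have k0 : 0 < k by apply: lt_le_trans k1.
(* This bound on [eps] yields [16 * k <= X], hence [r >= 3], and also [k * y <= s / 8], which keeps
   the window narrow. *)
exists (1 / (16 * k)); split; first by rewrite divr_gt0 // mulr_gt0.
(* A factor [4 * k] comes from [X <= 4 * k * r], and a factor 2 from the square on [q]. *)
exists (1 / (8 * k)); split; first by rewrite divr_gt0 // mulr_gt0.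
move=> n eps n0 eps_ge eps_lt q A At.
set s : R := Num.sqrt n%:R in eps_ge.
have s0 : 0 < s by rewrite sqrtr_gt0 ltr0n.
have ss : s ^+ 2 = n%:R by rewrite sqr_sqrtr // ler0n.
have es1 : 1 <= eps * s by rewrite -ler_pdivrMr.
have eps0 : 0 < eps by apply: lt_le_trans eps_ge; rewrite divr_gt0.
set X : R := n%:R `^ (1 / 4) / Num.sqrt eps.
have X0 : 0 < X by rewrite divr_gt0 ?sqrtr_gt0 // powR_gt0 // ltr0n.
have X2 : X ^+ 2 * eps = s.
  rewrite /X expr_div_n sqr_sqrtr ?ltW // divfK ?gt_eqF //.
  rewrite -powR_mulrn ?powR_ge0 // -powRrM.
  rewrite (_ : 1 / 4 * 2%:R = 2^-1); last by field.
  by rewrite powR12_sqrt // ler0n.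
clearbody X.
have Xeps : 1 <= X * eps.
  rewrite -(@expr_ge1 _ 2) // ?mulr_ge0 ?(ltW X0) ?(ltW eps0) //.
  by rewrite exprMn [eps ^+ 2]expr2 mulrA X2 mulrC.
have epsk : eps * (16 * k) <= 1.
  by move: eps_lt => /ltW; rewrite ler_pdivlMr // mulr_gt0.
have Xk : 16 * k <= X.
  have : eps * (16 * k) <= eps * X by apply: le_trans epsk _; rewrite [eps * X]mulrC.
  by rewrite ler_pM2l.
(* An integer between [eps * s] and [2 * (eps * s)], because [eps * s >= 1]. *)
pose y := (Num.truncn (eps * s)).+1.
have /andP[y_le y_gt] : (Num.truncn (eps * s))%:R <= eps * s < y%:R.
  by apply: truncn_itv; rewrite mulr_ge0 // ltW.
have y_le2 : y%:R <= 2 * (eps * s) by rewrite /y -natr1; lra.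
have y0 : 0 < y%:R :> R by rewrite ltr0n.
(* The real solution of [K ^ 2 * y * z ^ 2 = n], rounded down to [r]. *)
pose z : R := Num.sqrt (n%:R / (k ^+ 2 * y%:R)).
have z2 : z ^+ 2 * (k ^+ 2 * y%:R) = n%:R.
  rewrite sqr_sqrtr ?divr_ge0 ?mulr_ge0 ?sqr_ge0 ?ltW ?ltr0n //.
  by rewrite divfK // gt_eqF // mulr_gt0 // exprn_gt0.
have z0 : 0 <= z by apply: sqrtr_ge0.
pose r := Num.truncn z.
have /andP[r_le r_gt] : r%:R <= z < r.+1%:R by apply: truncn_itv.
have zX : X <= 2 * k * z.
  rewrite -(@ler_pXn2r _ 2) // ?nnegrE ?mulr_ge0 ?(ltW X0) ?(ltW k0) //.
  have : X ^+ 2 * (eps * s) <= (2 * k * z) ^+ 2 * (eps * s).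
    rewrite mulrA X2 -expr2 ss -z2.
    have -> : (2 * k * z) ^+ 2 * (eps * s) = 2 * (z ^+ 2 * (k ^+ 2 * (2 * (eps * s)))) by ring.
    have : z ^+ 2 * (k ^+ 2 * y%:R) <= z ^+ 2 * (k ^+ 2 * (2 * (eps * s))).
      by rewrite !ler_wpM2l // sqr_ge0.
    have : 0 <= z ^+ 2 * (k ^+ 2 * y%:R) by rewrite z2.
    lra.
  by rewrite ler_pM2r // mulr_gt0.
(* Rounding [z] down loses at most [2 * k], which is at most [X / 8]. *)
have rX : X <= 4 * k * r%:R.
  have h1 : 2 * k * z <= 2 * k * (r%:R + 1).
    by rewrite ler_wpM2l ?natr1 ?ltW // mulr_gt0.
  nra.
have r3 : (3 <= r)%N.
  rewrite -(@ler_nat R) -(ler_pM2l k0); lra.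
have At' := @queries_nat_bound R K n y r q eps A KE n0 isT r3 _ _ (ltW y_gt) At.
have {At'} qr : (2 ^ r <= q ^ 2)%N.
  apply: At'; rewrite -(@ler_nat R) !(natrM, natrX) -/k.
    rewrite -z2 mulrA mulrC ler_wpM2r //; first by rewrite mulr_ge0 ?sqr_ge0 // ltW.
    by rewrite ler_pXn2r // nnegrE.
  rewrite -ss.
  have : k * y%:R <= s / 8.
    have : k * y%:R <= k * (2 * (eps * s)) by rewrite ler_wpM2l // ltW.
    have : eps * (16 * k) * s <= 1 * s by rewrite ler_wpM2r // ltW.
    nra.
  move=> ky.
  have : (k * y%:R) ^+ 2 <= (s / 8) ^+ 2.
    have ky0 : 0 <= k * y%:R by rewrite mulr_ge0 // ltW.
    have s8 : 0 <= s / 8 by rewrite divr_ge0 // ltW.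
    by apply: lerXn2r; rewrite ?nnegrE.
  have -> : (s / 8) ^+ 2 = s ^+ 2 / 64 by field.
  have := sqr_ge0 s; lra.
rewrite -(@ler_pXn2r _ 2) // ?nnegrE ?powR_ge0 ?ler0n //.
apply: le_trans (_ : (2 ^ r)%:R <= _); last by rewrite -natrX ler_nat.
rewrite -powR_mulrn ?powR_ge0 // -powRrM natrX -powR_mulrn ?ler0n //.
apply: ler_powR; first by rewrite ler1n.
have -> : 1 / (8 * k) * X * 2 = X / (4 * k) by field; rewrite gt_eqF.
by rewrite ler_pdivrMr ?mulr_gt0 // mulrC.
Qed.
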